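(* Let $\tau\in\mathbb{C}$ with $\mathrm{Im}(\tau)>0$, let $q=e^{\pi i\tau}$ and $\tau'=-1/\tau$. For every complex number $z$, \[ \theta_1(3z\mid\tau')\,\theta_1^3\!\left(\tfrac{\pi}{2}\,\big|\,\tfrac{\tau'}{3}\right)+\theta_1^3\!\left(z\,\big|\,\tfrac{\tau'}{3}\right)\theta_1\!\left(\tfrac{\pi}{2}\,\big|\,\tau'\right) =\frac{\Pi_q}{\Pi_{q^3}}\,\theta_1\!\left(z\,\big|\,\tfrac{\tau'}{3}\right)\theta_1^2\!\left(z+\tfrac{\pi}{2}\,\big|\,\tfrac{\tau'}{3}\right)\theta_1\!\left(\tfrac{\pi}{2}\,\big|\,\tau'\right). \]
   Context: For $\sigma\in\mathbb{C}$ with $\mathrm{Im}(\sigma)>0$ and $z\in\mathbb{C}$, the first Jacobi theta function is \[ \theta_1(z\mid\sigma)=2\sum_{n=0}^{\infty}(-1)^n e^{\pi i\sigma(2n+1)^2/4}\sin((2n+1)z), \] and $\theta_1^m(z\mid\sigma)$ denotes its $m$-th power. For $|q|<1$, $(a;q)_\infty=\prod_{i=0}^{\infty}(1-aq^i)$. With $q=e^{\pi i\tau}$, \[ \Pi_q=q^{1/4}\frac{(q^2;q^2)_\infty^2}{(q;q^2)_\infty^2}, \] and for a positive integer $m$, $\Pi_{q^m}$ is the same expression with $q$ replaced by $q^m=e^{\pi i m\tau}$ (that is, $\tau$ replaced by $m\tau$). Fractional powers of $q$ are understood as $q^a=e^{\pi i\tau a}$. *)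

(* Defs.v *)
From Stdlib Require Import Reals.
From Coquelicot Require Import Coquelicot.
Open Scope C_scope.

Definition Cexp (z : C) : C :=
  (exp (Re z) * cos (Im z), exp (Re z) * sin (Im z))%R.

Definition Csin (z : C) : C := (Cexp (Ci * z) - Cexp (- (Ci * z))) / (2 * Ci).

(* A total limit operator: [iota P] is the unique element satisfying [P] when
   there is one, so the value is only meaningful for convergent sequences. *)
Definition Clim_seq (u : nat -> C) : C :=
  @iota C_CompleteNormedModule
    (fun l : C => filterlim u eventually (locally l)).

Lemma Clim_seq_unique (u : nat -> C) (l : C) :
  filterlim u eventually (locally l) -> Clim_seq u = l.
Proof.
  exact (@iota_filterlim_locally _ C_CompleteNormedModule _ eventually _ u l).
Qed.

(* [filterlim (sum_n a) eventually (locally l)] is, by definition,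
   [is_series a l]. *)
Definition CSeries (a : nat -> C) : C := Clim_seq (sum_n a).

Fixpoint Cprod (u : nat -> C) (n : nat) : C :=
  match n with
  | O => 1
  | S k => Cprod u k * u k
  end.

Definition qpoch_inf (a q : C) : C :=
  Clim_seq (Cprod (fun i => 1 - a * q ^ i)).

Definition theta1 (z sigma : C) : C :=
  2 * CSeries (fun n : nat =>
    (-1) ^ n
    * Cexp (PI * Ci * sigma * (2 * INR n + 1) ^ 2 / 4)
    * Csin ((2 * INR n + 1) * z)).

(* Fractional powers of the nome q = exp (pi i tau) depend on the choice of tau,
   so [Pi_q] takes tau rather than q; Pi_{q^m} is then [Pi_q (m * tau)]. *)
Definition nome (tau : C) : C := Cexp (PI * Ci * tau).

Definition Pi_q (tau : C) : C :=
  let q := nome tau in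
  Cexp (PI * Ci * tau / 4)
  * (qpoch_inf (q ^ 2) (q ^ 2) ^ 2 / qpoch_inf q (q ^ 2) ^ 2).

(* Main.v *)
(* Put s = -1/(3 tau), T = 3 tau. As functions of z, theta_1(3z|3s),
   theta_1(z|s)^3 and theta_1(z|s) theta_1(z+pi/2|s)^2 are odd theta functions
   of order 3 for the same multiplier, hence lie in a plane; comparing values at
   z = pi/2 and z = pi/3 gives the asserted relation with the constant
   (theta_1(pi/3|s) / theta_1(5pi/6|s))^2. The function
   exp(i T z^2/pi) theta_1(T z|T) has the quasi-periods of theta_1(z|s), a
   theta function of order 1, so it is proportional to it (the imaginary
   transformation, with a constant that cancels); the constant above thus becomes
   (up to an exponential) a ratio of theta_1(pi tau|3 tau) and
   theta_1(5 pi tau/2|3 tau), which the Jacobi triple product evaluates as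
   Pi_q / Pi_{q^3}.

   Both dimension counts rest on the fact that an entire pi-antiperiodic function
   with vanishing Fourier coefficients is zero. Coefficients are limits of means
   over N equally spaced nodes, which avoids integrals and Cauchy's theorem. *)
Require Import Defs.
From Stdlib Require Import Reals Lra Lia ZArith FunctionalExtensionality.
From Coquelicot Require Import Coquelicot.
Open Scope C_scope.

(** * Limits and series of complex numbers *)

(** The comparison points are chosen because one of the three functions vanishes at each: at pi/2
    the mixed product, at pi/3 the tripled function, both through theta_1(pi) = 0. The argument then
    needs values that do not vanish: the cube at pi/2 and the mixed product at pi/3 (independence),
    and theta_1(5 pi/6|s) as a denominator. The zero set of theta_1 is never determined;
    nonvanishing is read off the triple product. The imaginary transformation carries pi/2, pi/3, 5
    pi/6 to 3 pi tau/2, pi tau, 5 pi tau/2 with modulus 3 tau, where every factor is 1 - q^k with k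
    > 0 and |q| < 1. So the triple product serves both to evaluate and to exclude zeros.
    Coefficients exist because passing from N to 2N nodes changes a mean by O(1/N), which is
    summable along powers of two. They can be computed from any complex base point, and this freedom
    yields the recurrence between the coefficients of index m and m + 2p for a multiplier of order
    p. Antiperiodicity leaves only odd indices; for order 3 these form the classes 1, 3, -1 modulo
    6, and oddness ties -1 to 1, hence dimension at most 2. *)

Definition Ccvg (u : nat -> C) (l : C) : Prop :=
  is_lim_seq (fun n => Cmod (u n - l)) 0%R.

Lemma Ccvg_spec (u : nat -> C) (l : C) :
  Ccvg u l <-> forall eps : R, (0 < eps)%R ->
    exists N, forall n, (N <= n)%nat -> (Cmod (u n - l) < eps)%R.
Proof.
  unfold Ccvg. rewrite <- is_lim_seq_spec. simpl. split.
  - intros H eps He. destruct (H (mkposreal eps He)) as [N HN].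
    exists N. intros n Hn. specialize (HN n Hn). simpl in HN.
    rewrite Rminus_0_r, Rabs_pos_eq in HN by apply Cmod_ge_0. exact HN.
  - intros H eps. destruct (H eps (cond_pos eps)) as [N HN].
    exists N. intros n Hn.
    rewrite Rminus_0_r, Rabs_pos_eq by apply Cmod_ge_0. auto.
Qed.

Lemma Ccvg_filterlim (u : nat -> C) (l : C) :
  Ccvg u l <-> filterlim u eventually (@locally C_CompleteNormedModule l).
Proof.
  rewrite Ccvg_spec. rewrite filterlim_locally. split.
  - intros H eps. destruct (H eps (cond_pos eps)) as [N HN].
    exists N. intros n Hn. apply C_NormedModule_mixin_compat1.
    exact (HN n Hn).
  - intros H eps He.
    assert (Hs : (0 < sqrt 2)%R) by (apply sqrt_lt_R0; lra).
    (* Balls of [C] are measured coordinatewise, and the modulus can exceed the larger coordinate by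
       a factor of at most sqrt 2. *)
    assert (He' : (0 < eps / sqrt 2)%R) by (apply Rdiv_lt_0_compat; lra).
    destruct (H (mkposreal _ He')) as [N HN].
    exists N. intros n Hn.
    pose proof (C_NormedModule_mixin_compat2 _ _ _ (HN n Hn)) as K.
    simpl in K. replace eps with (sqrt 2 * (eps / sqrt 2))%R by (field; lra).
    exact K.
Qed.

Lemma Ccvg_unique (u : nat -> C) (l1 l2 : C) :
  Ccvg u l1 -> Ccvg u l2 -> l1 = l2.
Proof.
  intros H1 H2. apply Ccvg_filterlim in H1, H2.
  rewrite <- (Clim_seq_unique u l1 H1). exact (Clim_seq_unique u l2 H2).
Qed.

Lemma Clim_seq_Ccvg (u : nat -> C) (l : C) : Ccvg u l -> Clim_seq u = l.
Proof. intros H. apply Clim_seq_unique. now apply Ccvg_filterlim. Qed.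

Lemma Ccvg_ext (u v : nat -> C) (l : C) :
  (forall n, u n = v n) -> Ccvg u l -> Ccvg v l.
Proof.
  intros H. apply is_lim_seq_ext. intros n. now rewrite H.
Qed.

Lemma Ccvg_bound (u : nat -> C) (l : C) (v : nat -> R) :
  (forall n, Cmod (u n - l) <= v n)%R -> is_lim_seq v 0%R -> Ccvg u l.
Proof.
  intros H Hv. apply is_lim_seq_le_le with (fun _ => 0%R) v; auto.
  - intros n; split; [apply Cmod_ge_0 | apply H].
  - apply is_lim_seq_const.
Qed.

Lemma Ccvg_const (l : C) : Ccvg (fun _ => l) l.
Proof.
  apply Ccvg_bound with (fun _ => 0%R); [| apply is_lim_seq_const].
  intros _. replace (l - l) with (RtoC 0) by ring. rewrite Cmod_0; lra.
Qed.

Lemma Ccvg_plus (u v : nat -> C) (l m : C) :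
  Ccvg u l -> Ccvg v m -> Ccvg (fun n => u n + v n) (l + m).
Proof.
  intros Hu Hv.
  apply Ccvg_bound with (fun n => Cmod (u n - l) + Cmod (v n - m))%R.
  - intros n. replace (u n + v n - (l + m)) with ((u n - l) + (v n - m)) by ring.
    apply Cmod_triangle.
  - replace 0%R with (0 + 0)%R by ring. now apply is_lim_seq_plus'.
Qed.

Lemma Ccvg_scal (c : C) (u : nat -> C) (l : C) :
  Ccvg u l -> Ccvg (fun n => c * u n) (c * l).
Proof.
  intros Hu. apply Ccvg_bound with (fun n => Cmod c * Cmod (u n - l))%R.
  - intros n. replace (c * u n - c * l) with (c * (u n - l)) by ring.
    rewrite Cmod_mult; lra.
  - replace 0%R with (Cmod c * 0)%R by ring.
    apply (is_lim_seq_scal_l _ (Cmod c) 0%R Hu).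
Qed.

Lemma Ccvg_mult (u v : nat -> C) (l m : C) :
  Ccvg u l -> Ccvg v m -> Ccvg (fun n => u n * v n) (l * m).
Proof.
  intros Hu Hv.
  apply Ccvg_bound with (fun n => Cmod (u n - l) * Cmod (v n - m) +
     (Cmod m * Cmod (u n - l) + Cmod l * Cmod (v n - m)))%R.
  - intros n.
    replace (u n * v n - l * m) with
      ((u n - l) * (v n - m) + (m * (u n - l) + l * (v n - m))) by ring.
    rewrite <- !Cmod_mult.
    eapply Rle_trans; [apply Cmod_triangle |].
    apply Rplus_le_compat_l, Cmod_triangle.
  - replace 0%R with (0 * 0 + (Cmod m * 0 + Cmod l * 0))%R by ring.
    apply is_lim_seq_plus'; [now apply is_lim_seq_mult' |].
    apply is_lim_seq_plus'.
    + apply (is_lim_seq_scal_l _ (Cmod m) 0%R Hu).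
    + apply (is_lim_seq_scal_l _ (Cmod l) 0%R Hv).
Qed.

Lemma Ccvg_subseq (u : nat -> C) (l : C) (phi : nat -> nat) :
  (forall n, (n <= phi n)%nat) -> Ccvg u l -> Ccvg (fun n => u (phi n)) l.
Proof.
  intros Hphi Hu. apply Ccvg_spec. intros eps He.
  destruct (proj1 (Ccvg_spec u l) Hu eps He) as [N HN].
  exists N. intros n Hn. apply HN. specialize (Hphi n). lia.
Qed.

Lemma Ccvg_Cmod (u : nat -> C) (l : C) :
  Ccvg u l -> is_lim_seq (fun n => Cmod (u n)) (Cmod l).
Proof.
  intros Hu. apply is_lim_seq_spec. intros eps.
  destruct (proj1 (Ccvg_spec u l) Hu eps (cond_pos eps)) as [N HN].
  exists N. intros n Hn. eapply Rle_lt_trans; [| apply (HN n Hn)].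
  apply Rabs_le. split.
  - pose proof (Cmod_triangle (l - u n) (u n)) as K.
    replace (l - u n + u n) with l in K by ring.
    replace (l - u n) with (- (u n - l)) in K by ring.
    rewrite Cmod_opp in K. lra.
  - pose proof (Cmod_triangle (u n - l) l) as K.
    replace (u n - l + l) with (u n) in K by ring. lra.
Qed.

Lemma Ccvg_Cmod_le (u : nat -> C) (l : C) (B : R) :
  Ccvg u l -> (forall n, Cmod (u n) <= B)%R -> (Cmod l <= B)%R.
Proof.
  intros Hu HB.
  pose proof (is_lim_seq_le _ _ _ _ HB (Ccvg_Cmod _ _ Hu) (is_lim_seq_const B)) as K.
  exact K.
Qed.

(** The upper bound is exclusive, unlike that of [sum_n], so that empty sums and sums over exactly N
    nodes are expressible. *)
Fixpoint Csum (f : nat -> C) (n : nat) : C :=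
  match n with O => 0 | S k => Csum f k + f k end.

Lemma Csum_sum_n (f : nat -> C) (n : nat) : Csum f (S n) = sum_n f n.
Proof.
  induction n as [|n IH].
  - rewrite sum_O. simpl. ring.
  - rewrite sum_Sn, <- IH. reflexivity.
Qed.

Lemma Csum_ext (f g : nat -> C) (n : nat) :
  (forall k, (k < n)%nat -> f k = g k) -> Csum f n = Csum g n.
Proof.
  induction n as [|n IH]; intros H; simpl; [reflexivity|].
  rewrite IH, H; auto.
Qed.

Lemma Csum_plus (f g : nat -> C) (n : nat) :
  Csum (fun k => f k + g k) n = Csum f n + Csum g n.
Proof. induction n as [|n IH]; simpl; [ring|]. rewrite IH. ring. Qed.

Lemma Csum_scal (c : C) (f : nat -> C) (n : nat) :
  Csum (fun k => c * f k) n = c * Csum f n.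
Proof. induction n as [|n IH]; simpl; [ring|]. rewrite IH. ring. Qed.

Lemma Csum_const (c : C) (n : nat) : Csum (fun _ => c) n = INR n * c.
Proof.
  induction n as [|n IH]; [simpl; ring|]. simpl Csum.
  rewrite IH, S_INR, RtoC_plus. ring.
Qed.

Lemma Csum_shift (f : nat -> C) (n : nat) :
  Csum (fun k => f (S k)) n = Csum f (S n) - f O.
Proof.
  induction n as [|n IH]; [simpl; ring|].
  simpl Csum at 1. rewrite IH. simpl. ring.
Qed.

Lemma Csum_exchange (f : nat -> nat -> C) (n m : nat) :
  Csum (fun i => Csum (f i) m) n = Csum (fun j => Csum (fun i => f i j) n) m.
Proof.
  induction n as [|n IH]; simpl.
  - induction m as [|m IHm]; simpl; [reflexivity|]. rewrite <- IHm. ring.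
  - rewrite IH, <- Csum_plus. reflexivity.
Qed.

Lemma Csum_split (f : nat -> C) (n m : nat) :
  Csum f (n + m) = Csum f n + Csum (fun k => f (n + k)%nat) m.
Proof.
  induction m as [|m IH]; [rewrite Nat.add_0_r; simpl; ring|].
  rewrite Nat.add_succ_r. simpl. rewrite IH. ring.
Qed.

Fixpoint Rsum (f : nat -> R) (n : nat) : R :=
  match n with O => 0 | S k => Rsum f k + f k end.

Lemma Csum_Cmod (f : nat -> C) (b : nat -> R) (n : nat) :
  (forall k, (k < n)%nat -> Cmod (f k) <= b k)%R ->
  (Cmod (Csum f n) <= Rsum b n)%R.
Proof.
  induction n as [|n IH]; intros H; simpl; [rewrite Cmod_0; lra|].
  eapply Rle_trans; [apply Cmod_triangle|].
  apply Rplus_le_compat; [apply IH; auto | apply H; auto].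
Qed.

Lemma Rsum_const (c : R) (n : nat) : Rsum (fun _ => c) n = (INR n * c)%R.
Proof.
  induction n as [|n IH]; [simpl; ring|]. simpl Rsum.
  rewrite IH, S_INR. ring.
Qed.

Lemma Rsum_sum_n (f : nat -> R) (n : nat) : Rsum f (S n) = sum_n f n.
Proof.
  induction n as [|n IH].
  - rewrite sum_O. simpl. ring.
  - rewrite sum_Sn, <- IH. reflexivity.
Qed.

Lemma Rsum_le_Series (b : nat -> R) (n : nat) :
  (forall k, 0 <= b k)%R -> ex_series b -> (Rsum b n <= Series b)%R.
Proof.
  intros Hb He. assert (H : forall m, (Rsum b m <= Rsum b (S m))%R).
  { intros m. simpl. specialize (Hb m). lra. }
  apply Rle_trans with (Rsum b (S n)); [apply H|].
  rewrite Rsum_sum_n.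
  apply (is_lim_seq_incr_compare (sum_n b)).
  - apply Series_correct in He. exact He.
  - intros m. rewrite <- !Rsum_sum_n. apply H.
Qed.

(** [CSeries] is a total operator without meaning for divergent series, so every manipulation
    carries an explicit summable majorant. *)
Definition dominated (a : nat -> C) (b : nat -> R) : Prop :=
  (forall n, Cmod (a n) <= b n)%R /\ ex_series b.

Lemma dominated_ge_0 (a : nat -> C) (b : nat -> R) :
  dominated a b -> forall n, (0 <= b n)%R.
Proof.
  intros [H _] n. eapply Rle_trans; [apply Cmod_ge_0 | apply H].
Qed.

Lemma Ccvg_incr (u : nat -> C) (l : C) :
  Ccvg (fun n => u (S n)) l <-> Ccvg u l.
Proof.
  unfold Ccvg. symmetry. apply (is_lim_seq_incr_1 (fun n => Cmod (u n - l))).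
Qed.

Lemma CSeries_cvg (a : nat -> C) (b : nat -> R) :
  dominated a b -> Ccvg (Csum a) (CSeries a).
Proof.
  intros [H He].
  destruct (@ex_series_le C_AbsRing C_CompleteNormedModule a b) as [l Hl]; auto.
  assert (K : Ccvg (sum_n a) l) by (apply Ccvg_filterlim; exact Hl).
  unfold CSeries. rewrite (Clim_seq_Ccvg _ _ K).
  apply Ccvg_incr. revert K. apply Ccvg_ext.
  intros n. now rewrite Csum_sum_n.
Qed.

Lemma CSeries_unique (a : nat -> C) (l : C) :
  Ccvg (Csum a) l -> CSeries a = l.
Proof.
  intros H. apply Clim_seq_Ccvg. apply Ccvg_incr in H. revert H.
  apply Ccvg_ext, Csum_sum_n.
Qed.

Lemma CSeries_ext (a b : nat -> C) : (forall n, a n = b n) -> CSeries a = CSeries b.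
Proof.
  intros H. f_equal. now apply functional_extensionality.
Qed.

Lemma CSeries_plus (a a' : nat -> C) (b b' : nat -> R) :
  dominated a b -> dominated a' b' ->
  CSeries (fun n => a n + a' n) = CSeries a + CSeries a'.
Proof.
  intros H H'. apply CSeries_unique.
  apply Ccvg_ext with (fun n => Csum a n + Csum a' n).
  - intros n. now rewrite Csum_plus.
  - apply Ccvg_plus; eapply CSeries_cvg; eauto.
Qed.

Lemma CSeries_scal (c : C) (a : nat -> C) (b : nat -> R) :
  dominated a b -> CSeries (fun n => c * a n) = c * CSeries a.
Proof.
  intros H. apply CSeries_unique.
  apply Ccvg_ext with (fun n => c * Csum a n).
  - intros n. now rewrite Csum_scal.
  - apply Ccvg_scal. eapply CSeries_cvg; eauto.
Qed.

Lemma CSeries_Cmod_le (a : nat -> C) (b : nat -> R) :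
  dominated a b -> (Cmod (CSeries a) <= Series b)%R.
Proof.
  intros H. apply Ccvg_Cmod_le with (Csum a).
  - eapply CSeries_cvg; eauto.
  - intros n. eapply Rle_trans.
    + apply Csum_Cmod. intros k _. apply (proj1 H).
    + apply Rsum_le_Series; [now apply dominated_ge_0 with a | apply H].
Qed.

Lemma CSeries_incr (a : nat -> C) (b : nat -> R) :
  dominated a b -> CSeries a = a O + CSeries (fun n => a (S n)).
Proof.
  intros H.
  assert (E : CSeries (fun n => a (S n)) = CSeries a - a O).
  { apply CSeries_unique.
    apply Ccvg_ext with (fun n => Csum a (S n) + - a O).
    - intros n. rewrite Csum_shift. reflexivity.
    - unfold Cminus. apply Ccvg_plus; [| apply Ccvg_const].
      apply (proj2 (Ccvg_incr (Csum a) _)). eapply CSeries_cvg; eauto. }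
  rewrite E. ring.
Qed.

(** Dominated convergence for series, by an eps/3 argument: both tails are controlled by the tail of
    [b], uniformly in N, and the remaining finite sum converges termwise. *)
Lemma CSeries_tannery (a : nat -> nat -> C) (a0 : nat -> C) (b : nat -> R) :
  (forall N n, Cmod (a N n) <= b n)%R -> ex_series b ->
  (forall n, Ccvg (fun N => a N n) (a0 n)) ->
  Ccvg (fun N => CSeries (a N)) (CSeries a0).
Proof.
  intros H He Hc.
  assert (D : forall N, dominated (a N) b) by (intros N; split; auto).
  assert (D0 : dominated a0 b).
  { split; auto. intros n. apply Ccvg_Cmod_le with (fun N => a N n); auto. }
  assert (Hb : forall n, (0 <= b n)%R) by now apply dominated_ge_0 with a0.
  (* Stated for an arbitrary dominated [c], since it is applied to each [a N] and to the limit
     [a0]. *)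
  assert (Tail : forall c K, dominated c b ->
            (Cmod (CSeries c - Csum c K) <= Series b - Rsum b K)%R).
  { intros c K Dc.
    apply Ccvg_Cmod_le with (fun n => Csum c (K + n) - Csum c K).
    - unfold Cminus. apply Ccvg_plus; [| apply Ccvg_const].
      apply (Ccvg_subseq _ _ (fun n => (K + n)%nat)); [intros; lia|].
      eapply CSeries_cvg; eauto.
    - intros n. rewrite Csum_split.
      replace (Csum c K + Csum (fun k => c (K + k)%nat) n - Csum c K)
        with (Csum (fun k => c (K + k)%nat) n) by ring.
      eapply Rle_trans.
      + apply (Csum_Cmod _ (fun k => b (K + k)%nat)). intros k _. apply Dc.
      + pose proof (Rsum_le_Series b (K + n) Hb He) as L.
        assert (E : (Rsum b (K + n) = Rsum b K + Rsum (fun k => b (K + k)%nat) n)%R).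
        { clear. induction n as [|n IH]; [rewrite Nat.add_0_r; simpl; ring|].
          rewrite Nat.add_succ_r. simpl. rewrite IH. ring. }
        lra. }
  apply Ccvg_spec. intros eps Heps.
  assert (HK : exists K, (Series b - Rsum b K < eps / 3)%R).
  { pose proof (Series_correct b He) as HS.
    assert (HS' : is_lim_seq (sum_n b) (Series b)) by exact HS.
    apply is_lim_seq_spec in HS'.
    assert (He3 : (0 < eps / 3)%R) by lra.
    destruct (HS' (mkposreal _ He3)) as [K HK].
    exists (S K). specialize (HK K (le_n K)). simpl in HK.
    rewrite Rsum_sum_n. apply Rabs_def2 in HK. lra. }
  destruct HK as [K HK].
  assert (Fin : Ccvg (fun N => Csum (a N) K) (Csum a0 K)).
  { clear - Hc. induction K as [|K IH]; simpl; [apply Ccvg_const|].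
    apply Ccvg_plus; auto. }
  assert (He3 : (0 < eps / 3)%R) by lra.
  destruct (proj1 (Ccvg_spec _ _) Fin _ He3) as [N0 HN0].
  exists N0. intros N HN. specialize (HN0 N HN).
  pose proof (Tail _ K (D N)) as T1. pose proof (Tail _ K D0) as T2.
  replace (CSeries (a N) - CSeries a0) with
    ((CSeries (a N) - Csum (a N) K) +
     ((Csum (a N) K - Csum a0 K) + - (CSeries a0 - Csum a0 K))) by ring.
  eapply Rle_lt_trans; [apply Cmod_triangle|].
  eapply Rle_lt_trans; [apply Rplus_le_compat_l, Cmod_triangle|].
  rewrite Cmod_opp. lra.
Qed.

(** * The complex exponential and sums over Z *)

Lemma exp_le_compat (x y : R) : (x <= y -> exp x <= exp y)%R.
Proof. intros [H|H]; [left; now apply exp_increasing | right; now rewrite H]. Qed.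

Lemma Cexp_plus (a b : C) : Cexp (a + b) = Cexp a * Cexp b.
Proof.
  destruct a as [a1 a2], b as [b1 b2].
  unfold Cexp, Cplus, Cmult, Re, Im; simpl.
  rewrite exp_plus, cos_plus, sin_plus. f_equal; ring.
Qed.

Lemma Cexp_0 : Cexp 0 = 1.
Proof.
  unfold Cexp, RtoC, Re, Im; simpl. rewrite exp_0, cos_0, sin_0. f_equal; ring.
Qed.

Lemma Cmod_Cexp (z : C) : Cmod (Cexp z) = exp (Re z).
Proof.
  unfold Cmod, Cexp; cbn [fst snd].
  replace ((exp (Re z) * cos (Im z)) ^ 2 + (exp (Re z) * sin (Im z)) ^ 2)%R
    with ((exp (Re z))² * ((sin (Im z))² + (cos (Im z))²))%R
    by (unfold Rsqr; ring).
  rewrite sin2_cos2, Rmult_1_r. apply sqrt_Rsqr. left; apply exp_pos.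
Qed.

Lemma Cexp_neq_0 (z : C) : Cexp z <> 0.
Proof.
  intros H. pose proof (exp_pos (Re z)) as K.
  rewrite <- Cmod_Cexp, H, Cmod_0 in K. lra.
Qed.

Lemma Cexp_opp (z : C) : Cexp (- z) * Cexp z = 1.
Proof. rewrite <- Cexp_plus. replace (- z + z) with (RtoC 0) by ring. apply Cexp_0. Qed.

Lemma Cexp_pow (z : C) (n : nat) : Cexp z ^ n = Cexp (INR n * z).
Proof.
  induction n as [|n IH].
  - simpl. replace (0 * z) with (RtoC 0) by ring. now rewrite Cexp_0.
  - rewrite Cpow_S, IH, S_INR, RtoC_plus, <- Cexp_plus. f_equal. ring.
Qed.

Lemma Cexp_PI : Cexp (PI * Ci) = -1.
Proof.
  unfold Cexp, RtoC, Ci, Cmult, Re, Im; simpl.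
  replace (PI * 0 - 0 * 1)%R with 0%R by ring.
  replace (PI * 1 + 0 * 0)%R with PI by ring.
  rewrite exp_0, cos_PI, sin_PI. f_equal; ring.
Qed.

Lemma Cexp_2PI : Cexp (2 * PI * Ci) = 1.
Proof.
  replace (2 * PI * Ci) with (PI * Ci + PI * Ci) by ring.
  rewrite Cexp_plus, Cexp_PI. rewrite <- RtoC_mult. f_equal; ring.
Qed.

Lemma Cexp_2PI_Z (n : Z) : Cexp (2 * PI * Ci * IZR n) = 1.
Proof.
  assert (H : forall m : nat, Cexp (2 * PI * Ci * INR m) = 1).
  { intros m. rewrite Cmult_comm, <- Cexp_pow, Cexp_2PI. apply Cpow_1_l. }
  destruct (Z.le_ge_cases 0 n) as [Hn|Hn].
  - rewrite <- (Z2Nat.id n Hn), <- INR_IZR_INZ. apply H.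
  - pose proof (Cexp_opp (2 * PI * Ci * IZR n)) as K.
    replace (- (2 * PI * Ci * IZR n)) with (2 * PI * Ci * INR (Z.to_nat (- n))) in K.
    + rewrite H in K. now rewrite Cmult_1_l in K.
    + rewrite INR_IZR_INZ, Z2Nat.id, opp_IZR, RtoC_opp by lia. ring.
Qed.

Lemma Cmod_le_Re_Im (z : C) : (Cmod z <= Rabs (Re z) + Rabs (Im z))%R.
Proof.
  replace z with (RtoC (Re z) + Ci * RtoC (Im z)) at 1.
  - eapply Rle_trans; [apply Cmod_triangle|].
    rewrite Cmod_mult, Cmod_Ci, !Cmod_R. lra.
  - destruct z as [a b]. unfold RtoC, Ci, Cplus, Cmult, Re, Im; simpl. f_equal; ring.
Qed.

Lemma Im_le_Cmod (z : C) : (Rabs (Im z) <= Cmod z)%R.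
Proof.
  eapply Rle_trans; [| apply Rmax_Cmod]. apply Rmax_r.
Qed.

Lemma Rabs_exp_sub_1_le (a : R) : (Rabs (exp a - 1) <= Rabs a * exp (Rabs a))%R.
Proof.
  pose proof (exp_ineq1_le a) as H1. pose proof (exp_ineq1_le (- a)) as H2.
  assert (E : (exp (- a) * exp a = 1)%R).
  { rewrite <- exp_plus, Rplus_opp_l. apply exp_0. }
  pose proof (exp_pos a) as P. pose proof (exp_ineq1_le (Rabs a)) as H3.
  pose proof (Rabs_pos a) as H4.
  destruct (Rle_lt_dec 0 a) as [Ha|Ha].
  - rewrite (Rabs_pos_eq a) in * by lra. rewrite Rabs_pos_eq by lra. nra.
  - rewrite (Rabs_left a) in * by lra.
    assert (exp a <= 1)%R by nra.
    rewrite Rabs_left1 by lra. nra.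
Qed.

Lemma Rabs_exp_taylor_le (a : R) : (Rabs (exp a - 1 - a) <= a ^ 2 * exp (Rabs a))%R.
Proof.
  pose proof (exp_ineq1_le a) as H1. pose proof (exp_ineq1_le (- a)) as H2.
  assert (E : (exp (- a) * exp a = 1)%R).
  { rewrite <- exp_plus, Rplus_opp_l. apply exp_0. }
  pose proof (exp_pos a) as P.
  assert (K : (exp a - 1 - a <= a * (exp a - 1))%R) by nra.
  rewrite Rabs_pos_eq by lra. eapply Rle_trans; [exact K|].
  eapply Rle_trans; [apply Rle_abs|]. rewrite Rabs_mult.
  pose proof (Rabs_exp_sub_1_le a) as L. pose proof (Rabs_pos a).
  replace (a ^ 2)%R with (Rabs a * Rabs a)%R
    by (rewrite <- Rabs_mult, Rabs_pos_eq; nra).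
  nra.
Qed.

Lemma one_minus_cos_le (b : R) : (Rabs (cos b - 1) <= b ^ 2)%R.
Proof.
  replace b with (2 * (b / 2))%R at 1 by field.
  rewrite cos_2a_sin.
  replace (1 - 2 * sin (b / 2) * sin (b / 2) - 1)%R
    with (- (2 * (sin (b / 2))²))%R by (unfold Rsqr; ring).
  rewrite Rabs_Ropp, Rabs_pos_eq.
  2:{ pose proof (Rle_0_sqr (sin (b / 2))). lra. }
  assert (H : (Rabs (sin (b / 2)) <= Rabs (b / 2))%R).
  { destruct (Rle_lt_dec 0 (b / 2)) as [Hb|Hb].
    - rewrite (Rabs_pos_eq (b / 2)) by lra. apply Rabs_le.
      pose proof (SIN_bound (b / 2)).
      destruct (Req_dec (b / 2) 0) as [E|E]; [rewrite E, sin_0; lra|].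
      pose proof (sin_lt_x (b / 2)).
      destruct (Rle_lt_dec (b / 2) PI).
      + pose proof (sin_ge_0 (b / 2)). lra.
      + pose proof PI2_1. lra.
    - rewrite (Rabs_left (b / 2)) by lra.
      rewrite <- (Rabs_Ropp (sin _)), <- sin_neg. apply Rabs_le.
      pose proof (SIN_bound (- (b / 2))).
      pose proof (sin_lt_x (- (b / 2))).
      destruct (Rle_lt_dec (- (b / 2)) PI).
      + pose proof (sin_ge_0 (- (b / 2))). lra.
      + pose proof PI2_1. lra. }
  apply Rsqr_le_abs_1 in H. unfold Rsqr in *. nra.
Qed.

Lemma sin_ge_cubic (b : R) : (0 <= b <= PI)%R -> (b - b ^ 3 / 6 <= sin b)%R.
Proof.
  intros [H0 H1]. destruct (sin_bound b 0 H0 H1) as [H _].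
  eapply Rle_trans; [| exact H]. right.
  unfold sin_approx, sin_term. simpl. field.
Qed.

(** The cubic lower bound for the sine settles 0 <= x <= 2; beyond 2 the trivial bound x + 1 <= x^2
    is enough, and negative arguments follow by oddness. *)
Lemma sin_sub_le (b : R) : (Rabs (sin b - b) <= b ^ 2)%R.
Proof.
  assert (K : forall x, (0 <= x)%R -> (Rabs (sin x - x) <= x ^ 2)%R).
  { intros x Hx. pose proof PI2_1 as HP. pose proof (SIN_bound x) as HS.
    destruct (Rle_lt_dec x 2) as [H2|H2].
    - pose proof (sin_ge_cubic x). 
      assert (sin x <= x)%R.
      { destruct (Req_dec x 0) as [E|E]; [rewrite E, sin_0; lra|].
        left; apply sin_lt_x; lra. }
      rewrite Rabs_left1 by lra.
      assert (x ^ 3 / 6 <= x ^ 2)%R by nra. lra.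
    - apply Rabs_le. nra. }
  destruct (Rle_lt_dec 0 b) as [Hb|Hb]; [auto|].
  specialize (K (- b)%R ltac:(lra)). rewrite sin_neg in K.
  replace (- sin b - - b)%R with (- (sin b - b))%R in K by ring.
  rewrite Rabs_Ropp in K. nra.
Qed.

(** Real and imaginary parts are estimated separately. Only the quadratic order matters later; the 3
    comes from a^2 + 2 b^2 + |a||b| <= 3 (a^2 + b^2). *)
Lemma Cexp_taylor (w : C) :
  (Cmod (Cexp w - 1 - w) <= 3 * Cmod w ^ 2 * exp (Cmod w))%R.
Proof.
  eapply Rle_trans; [apply Cmod_le_Re_Im|].
  pose proof (re_le_Cmod w) as Ha. pose proof (Im_le_Cmod w) as Hb.
  pose proof (Cmod2_alt w) as Hm.
  destruct w as [a b]. unfold Cexp, Cminus, Cplus, Copp, RtoC. 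
  cbn [Re Im fst snd] in *.
  set (m := Cmod (a, b)) in *.
  replace (exp a * cos b + - (1) + - a)%R
    with ((exp a - 1 - a) + exp a * (cos b - 1))%R by ring.
  replace (exp a * sin b + - 0 + - b)%R
    with (exp a * (sin b - b) + (exp a - 1) * b)%R by ring.
  pose proof (Rabs_exp_taylor_le a) as T1.
  pose proof (Rabs_exp_sub_1_le a) as T2.
  pose proof (one_minus_cos_le b) as T3. pose proof (sin_sub_le b) as T4.
  assert (Ea : (exp (Rabs a) <= exp m)%R) by now apply exp_le_compat.
  assert (Eb : (exp a <= exp m)%R).
  { apply exp_le_compat. pose proof (Rle_abs a). lra. }
  pose proof (exp_pos a) as P1. pose proof (exp_pos m) as P2.
  pose proof (Rabs_pos a) as Pa. pose proof (Rabs_pos b) as Pb.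
  assert (Sa : (a ^ 2 = Rabs a * Rabs a)%R).
  { rewrite <- Rabs_mult, Rabs_pos_eq; nra. }
  assert (Sb : (b ^ 2 = Rabs b * Rabs b)%R).
  { rewrite <- Rabs_mult, Rabs_pos_eq; nra. }
  assert (U1 : (Rabs (exp a - 1 - a + exp a * (cos b - 1)) <= a ^ 2 * exp m + exp m * b ^ 2)%R).
  { eapply Rle_trans; [apply Rabs_triang|]. apply Rplus_le_compat.
    - eapply Rle_trans; [exact T1|]. apply Rmult_le_compat_l; nra.
    - rewrite Rabs_mult, (Rabs_pos_eq (exp a)) by lra.
      apply Rmult_le_compat; auto using Rabs_pos; lra. }
  assert (U2 : (Rabs (exp a * (sin b - b) + (exp a - 1) * b) <= exp m * b ^ 2 + Rabs a * Rabs b * exp m)%R).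
  { eapply Rle_trans; [apply Rabs_triang|]. apply Rplus_le_compat.
    - rewrite Rabs_mult, (Rabs_pos_eq (exp a)) by lra.
      apply Rmult_le_compat; auto using Rabs_pos; lra.
    - rewrite Rabs_mult.
      apply Rle_trans with (Rabs a * exp (Rabs a) * Rabs b)%R.
      + apply Rmult_le_compat_r; auto.
      + replace (Rabs a * Rabs b * exp m)%R with (Rabs a * exp m * Rabs b)%R by ring.
        apply Rmult_le_compat_r; auto. apply Rmult_le_compat_l; auto. }
  assert (V : (a ^ 2 + b ^ 2 + b ^ 2 + Rabs a * Rabs b <= 3 * m ^ 2)%R) by nra.
  apply Rle_trans with ((a ^ 2 + b ^ 2 + b ^ 2 + Rabs a * Rabs b) * exp m)%R; [lra|].
  apply Rmult_le_compat_r; lra.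
Qed.

(** The negative half starts at -1, so each integer occurs once, and the reflection n -> -n - 1
    exchanges the two halves exactly. *)
Definition ZSum (f : Z -> C) : C :=
  CSeries (fun n => f (Z.of_nat n)) + CSeries (fun n => f (- Z.of_nat n - 1)%Z).

(** One fixed majorant up to a constant: an index shift by k costs only the factor exp |k|, and
    uniformity in a parameter means that [K] does not depend on it. *)
Definition Zdecay (f : Z -> C) (K : R) : Prop :=
  forall n, (Cmod (f n) <= K * exp (- Rabs (IZR n)))%R.

Lemma ex_series_exp (K : R) : ex_series (fun n => K * exp (- INR n))%R.
Proof.
  apply (ex_series_scal_l K (fun n => exp (- INR n))%R).
  apply (ex_series_ext (fun n => exp (-1) ^ n)%R).
  - intros n. induction n as [|n IH]; [simpl; now rewrite Ropp_0, exp_0|].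
    change (exp (-1) * exp (-1) ^ n = exp (- INR (S n)))%R.
    rewrite IH, <- exp_plus, S_INR. f_equal. ring.
  - apply ex_series_geom. rewrite Rabs_pos_eq by (left; apply exp_pos).
    rewrite <- exp_0. apply exp_increasing. lra.
Qed.

Lemma Zdecay_ge_0 (f : Z -> C) (K : R) : Zdecay f K -> (0 <= K)%R.
Proof.
  intros H. specialize (H 0%Z). rewrite Rabs_R0, Ropp_0, exp_0 in H.
  pose proof (Cmod_ge_0 (f 0%Z)). lra.
Qed.

Lemma Zdecay_pos (f : Z -> C) (K : R) : Zdecay f K ->
  dominated (fun n => f (Z.of_nat n)) (fun n => K * exp (- INR n))%R.
Proof.
  intros H. split; [| apply ex_series_exp]. intros n.
  specialize (H (Z.of_nat n)). rewrite <- INR_IZR_INZ in H.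
  now rewrite Rabs_pos_eq in H by apply pos_INR.
Qed.

Lemma Zdecay_neg (f : Z -> C) (K : R) : Zdecay f K ->
  dominated (fun n => f (- Z.of_nat n - 1)%Z) (fun n => K * exp (- INR n))%R.
Proof.
  intros H. split; [| apply ex_series_exp]. intros n.
  pose proof (Zdecay_ge_0 f K H) as HK.
  eapply Rle_trans; [apply H|]. apply Rmult_le_compat_l; auto.
  apply exp_le_compat. rewrite minus_IZR, opp_IZR, <- INR_IZR_INZ.
  pose proof (pos_INR n). rewrite Rabs_left1; lra.
Qed.

Lemma ZSum_ext (f g : Z -> C) : (forall n, f n = g n) -> ZSum f = ZSum g.
Proof. intros H. f_equal. now apply functional_extensionality. Qed.

Lemma ZSum_plus (f g : Z -> C) (K L : R) : Zdecay f K -> Zdecay g L ->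
  ZSum (fun n => f n + g n) = ZSum f + ZSum g.
Proof.
  intros Hf Hg. unfold ZSum.
  rewrite (CSeries_plus _ _ _ _ (Zdecay_pos f K Hf) (Zdecay_pos g L Hg)).
  rewrite (CSeries_plus _ _ _ _ (Zdecay_neg f K Hf) (Zdecay_neg g L Hg)). ring.
Qed.

Lemma ZSum_scal (c : C) (f : Z -> C) (K : R) : Zdecay f K ->
  ZSum (fun n => c * f n) = c * ZSum f.
Proof.
  intros Hf. unfold ZSum.
  rewrite (CSeries_scal _ _ _ (Zdecay_pos f K Hf)).
  rewrite (CSeries_scal _ _ _ (Zdecay_neg f K Hf)). ring.
Qed.

Lemma Zdecay_plus (f g : Z -> C) (K L : R) : Zdecay f K -> Zdecay g L ->
  Zdecay (fun n => f n + g n) (K + L).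
Proof.
  intros Hf Hg n. eapply Rle_trans; [apply Cmod_triangle|].
  rewrite Rmult_plus_distr_r. apply Rplus_le_compat; auto.
Qed.

Lemma Zdecay_scal (c : C) (f : Z -> C) (K : R) : Zdecay f K ->
  Zdecay (fun n => c * f n) (Cmod c * K).
Proof.
  intros Hf n. rewrite Cmod_mult, Rmult_assoc.
  apply Rmult_le_compat_l; auto using Cmod_ge_0.
Qed.

Lemma Zdecay_shift (f : Z -> C) (K : R) (k : Z) : Zdecay f K ->
  Zdecay (fun n => f (n + k)%Z) (K * exp (Rabs (IZR k))).
Proof.
  intros H n. eapply Rle_trans; [apply H|].
  rewrite Rmult_assoc, <- exp_plus.
  apply Rmult_le_compat_l; [exact (Zdecay_ge_0 f K H)|].
  apply exp_le_compat. rewrite plus_IZR.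
  pose proof (Rabs_triang (IZR n + IZR k) (- IZR k)) as T.
  rewrite Rabs_Ropp in T.
  replace (IZR n + IZR k + - IZR k)%R with (IZR n) in T by ring. lra.
Qed.

(** The shift moves the single term [f 0] from the nonnegative half to the negative half. *)
Lemma ZSum_succ (f : Z -> C) (K : R) : Zdecay f K ->
  ZSum (fun n => f (n + 1)%Z) = ZSum f.
Proof.
  intros H. unfold ZSum.
  rewrite (CSeries_incr _ _ (Zdecay_pos f K H)).
  pose proof (Zdecay_neg _ _ (Zdecay_shift f K 1 H)) as H'.
  rewrite (CSeries_incr _ _ H').
  change (- Z.of_nat 0 - 1 + 1)%Z with 0%Z. change (Z.of_nat 0) with 0%Z.
  rewrite (CSeries_ext (fun n => f (Z.of_nat n + 1)%Z) (fun n => f (Z.of_nat (S n)))).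
  2:{ intros n. f_equal. lia. }
  rewrite (CSeries_ext (fun n => f (- Z.of_nat (S n) - 1 + 1)%Z)
             (fun n => f (- Z.of_nat n - 1)%Z)).
  2:{ intros n. f_equal. lia. }
  ring.
Qed.

Lemma ZSum_reflect (f : Z -> C) : ZSum (fun n => f (- n - 1)%Z) = ZSum f.
Proof.
  unfold ZSum. rewrite Cplus_comm. f_equal.
  apply CSeries_ext; intros n; f_equal; lia.
Qed.

Definition exp_series : R := Series (fun n => exp (- INR n)).

Lemma ZSum_Cmod_le (f : Z -> C) (K : R) : Zdecay f K ->
  (Cmod (ZSum f) <= K * (2 * exp_series))%R.
Proof.
  intros H. unfold ZSum. eapply Rle_trans; [apply Cmod_triangle|].
  pose proof (CSeries_Cmod_le _ _ (Zdecay_pos f K H)) as H1.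
  pose proof (CSeries_Cmod_le _ _ (Zdecay_neg f K H)) as H2.
  rewrite Series_scal_l in H1, H2. unfold exp_series. lra.
Qed.

Lemma ZSum_tannery (a : nat -> Z -> C) (a0 : Z -> C) (K : R) :
  (forall N, Zdecay (a N) K) ->
  (forall n, Ccvg (fun N => a N n) (a0 n)) ->
  Ccvg (fun N => ZSum (a N)) (ZSum a0).
Proof.
  intros H Hc. unfold ZSum. apply Ccvg_plus.
  - apply (CSeries_tannery (fun N n => a N (Z.of_nat n)) _ (fun n => K * exp (- INR n))%R).
    + intros N. apply (Zdecay_pos _ _ (H N)).
    + apply ex_series_exp.
    + intros n. apply Hc.
  - apply (CSeries_tannery (fun N n => a N (- Z.of_nat n - 1)%Z) _ (fun n => K * exp (- INR n))%R).
    + intros N. apply (Zdecay_neg _ _ (H N)).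
    + apply ex_series_exp.
    + intros n. apply Hc.
Qed.

(** * Entire functions *)

(** One constant bounds value, derivative and remainder, so that the closure proofs carry a single
    number; increments are limited to the unit disc. *)
Definition taylor_bound (F F' : C -> C) (M B : R) : Prop :=
  forall u, (Cmod u <= M)%R ->
    (Cmod (F u) <= B)%R /\ (Cmod (F' u) <= B)%R /\
    forall h, (Cmod h <= 1)%R ->
      (Cmod (F (u + h)%C - F u - h * F' u) <= B * Cmod h ^ 2)%R.

(* Entire functions are only ever used through locally uniform second-order
   Taylor estimates, so this is taken as the definition. *)
Definition entire (F : C -> C) : Prop :=
  exists F', forall M, exists B, taylor_bound F F' M B.

Lemma taylor_bound_le (F F' : C -> C) (M B B' : R) :
  taylor_bound F F' M B -> (B <= B')%R -> taylor_bound F F' M B'.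
Proof.
  intros H HB u Hu. destruct (H u Hu) as (H1 & H2 & H3).
  repeat split; try lra. intros h Hh. eapply Rle_trans; [now apply H3|].
  apply Rmult_le_compat_r; [apply pow2_ge_0 | exact HB].
Qed.

Lemma taylor_bound_pos (F F' : C -> C) :
  (forall M, exists B, taylor_bound F F' M B) ->
  forall M, exists B, (0 <= B)%R /\ taylor_bound F F' M B.
Proof.
  intros H M. destruct (H M) as [B HB]. exists (Rmax 0 B). split; [apply Rmax_l|].
  apply taylor_bound_le with B; auto. apply Rmax_r.
Qed.

Lemma entire_ext (F G : C -> C) : (forall z, F z = G z) -> entire F -> entire G.
Proof.
  intros E H. replace G with F; [exact H | now apply functional_extensionality].
Qed.

Lemma entire_const (c : C) : entire (fun _ => c).
Proof.
  exists (fun _ => 0). intros M. exists (Cmod c). intros u Hu.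
  repeat split; [lra | rewrite Cmod_0; apply Cmod_ge_0 |].
  intros h Hh. replace (c - c - h * 0) with (RtoC 0) by ring. rewrite Cmod_0.
  apply Rmult_le_pos; [apply Cmod_ge_0 | apply pow2_ge_0].
Qed.

Lemma entire_id : entire (fun z => z).
Proof.
  exists (fun _ => 1). intros M. exists (Rmax M 1). intros u Hu.
  pose proof (Rmax_l M 1). pose proof (Rmax_r M 1).
  repeat split; [lra | rewrite Cmod_1; lra |].
  intros h Hh. replace (u + h - u - h * 1) with (RtoC 0) by ring. rewrite Cmod_0.
  apply Rmult_le_pos; [lra | apply pow2_ge_0].
Qed.

Lemma entire_plus (F G : C -> C) :
  entire F -> entire G -> entire (fun z => F z + G z).
Proof.
  intros [F' HF] [G' HG]. exists (fun z => F' z + G' z). intros M.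
  destruct (HF M) as [B HB]. destruct (HG M) as [B' HB'].
  exists (B + B')%R. intros u Hu.
  destruct (HB u Hu) as (H1 & H2 & H3). destruct (HB' u Hu) as (K1 & K2 & K3).
  repeat split; try (eapply Rle_trans; [apply Cmod_triangle | lra]).
  intros h Hh.
  replace (F (u + h) + G (u + h) - (F u + G u) - h * (F' u + G' u))
    with ((F (u + h) - F u - h * F' u) + (G (u + h) - G u - h * G' u)) by ring.
  eapply Rle_trans; [apply Cmod_triangle|].
  specialize (H3 h Hh). specialize (K3 h Hh). lra.
Qed.

Lemma entire_mult (F G : C -> C) :
  entire F -> entire G -> entire (fun z => F z * G z).
Proof.
  intros [F' HF] [G' HG]. exists (fun z => F' z * G z + F z * G' z). intros M.
  destruct (taylor_bound_pos _ _ HF M) as [B [P HB]].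
  destruct (taylor_bound_pos _ _ HG M) as [B' [P' HB']].
  (* With [r], [s] the two remainders, the remainder of the product splits into three pieces,
     bounded by 1, 3 and 2 times B B' |h|^2. *)
  exists (6 * (B * B'))%R. intros u Hu.
  destruct (HB u Hu) as (H1 & H2 & H3). destruct (HB' u Hu) as (K1 & K2 & K3).
  pose proof (Cmod_ge_0 (F u)) as Q1. pose proof (Cmod_ge_0 (G u)) as Q2.
  pose proof (Cmod_ge_0 (F' u)) as Q3. pose proof (Cmod_ge_0 (G' u)) as Q4.
  pose proof (Rmult_le_pos _ _ P P') as PP.
  assert (L : forall x y, (0 <= x <= B -> 0 <= y <= B' -> x * y <= B * B')%R).
  { intros x y Hx Hy. apply Rmult_le_compat; lra. }
  repeat split.
  - rewrite Cmod_mult. specialize (L (Cmod (F u)) (Cmod (G u))). lra.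
  - eapply Rle_trans; [apply Cmod_triangle|]. rewrite !Cmod_mult.
    pose proof (L (Cmod (F' u)) (Cmod (G u))).
    pose proof (L (Cmod (F u)) (Cmod (G' u))). lra.
  - intros h Hh. specialize (H3 h Hh). specialize (K3 h Hh).
    set (r := F (u + h) - F u - h * F' u) in *.
    set (s := G (u + h) - G u - h * G' u) in *.
    replace (F (u + h)) with (F u + h * F' u + r) by (unfold r; ring).
    replace (G (u + h)) with (G u + h * G' u + s) by (unfold s; ring).
    replace ((F u + h * F' u + r) * (G u + h * G' u + s) - F u * G u -
      h * (F' u * G u + F u * G' u)) with
      (h * h * (F' u * G' u) + (r * (G u + h * G' u + s) + (F u + h * F' u) * s)) by ring.
    pose proof (Cmod_ge_0 h) as Qh. pose proof (Cmod_ge_0 r) as Qr.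
    pose proof (Cmod_ge_0 s) as Qs.
    assert (Hh2 : (Cmod h ^ 2 <= 1)%R) by nra.
    assert (Ph2 : (0 <= Cmod h ^ 2)%R) by nra.
    assert (T1 : (Cmod (h * h * (F' u * G' u)) <= (B * B') * Cmod h ^ 2)%R).
    { rewrite !Cmod_mult. pose proof (L (Cmod (F' u)) (Cmod (G' u))). nra. }
    assert (T2 : (Cmod (G u + h * G' u + s) <= 3 * B')%R).
    { eapply Rle_trans; [apply Cmod_triangle|].
      eapply Rle_trans; [apply Rplus_le_compat_r, Cmod_triangle|].
      rewrite Cmod_mult. nra. }
    assert (T3 : (Cmod (F u + h * F' u) <= 2 * B)%R).
    { eapply Rle_trans; [apply Cmod_triangle|]. rewrite Cmod_mult. nra. }
    pose proof (Cmod_ge_0 (G u + h * G' u + s)). pose proof (Cmod_ge_0 (F u + h * F' u)).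
    assert (T4 : (Cmod (r * (G u + h * G' u + s)) <= (B * Cmod h ^ 2) * (3 * B'))%R).
    { rewrite Cmod_mult. apply Rmult_le_compat; auto. }
    assert (T5 : (Cmod ((F u + h * F' u) * s) <= (2 * B) * (B' * Cmod h ^ 2))%R).
    { rewrite Cmod_mult. apply Rmult_le_compat; auto. }
    eapply Rle_trans; [apply Cmod_triangle|].
    eapply Rle_trans; [apply Rplus_le_compat_l, Cmod_triangle|]. lra.
Qed.

Lemma entire_scal (c : C) (F : C -> C) : entire F -> entire (fun z => c * F z).
Proof. intros H. apply entire_mult; [apply entire_const | exact H]. Qed.

Lemma entire_exp (F : C -> C) : entire F -> entire (fun z => Cexp (F z)).
Proof.
  intros [F' HF]. exists (fun z => F' z * Cexp (F z)). intros M.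
  destruct (taylor_bound_pos _ _ HF M) as [B [P HB]].
  (* The increment [d] of F has modulus at most 2 B |h|; inserting it in [Cexp_taylor] gives 3
     (2B)^2 = 12 B^2. *)
  exists (exp B * (1 + 2 * B + 12 * B ^ 2 * exp (2 * B)))%R. intros u Hu.
  destruct (HB u Hu) as (H1 & H2 & H3).
  pose proof (exp_pos B) as PB. pose proof (exp_pos (2 * B)) as P2B.
  assert (Q : (0 <= 12 * B ^ 2 * exp (2 * B))%R).
  { apply Rmult_le_pos; nra. }
  assert (E : (0 <= Cmod (Cexp (F u)) <= exp B)%R).
  { split; [apply Cmod_ge_0|]. rewrite Cmod_Cexp. apply exp_le_compat.
    pose proof (re_le_Cmod (F u)). pose proof (Rle_abs (Re (F u))). lra. }
  repeat split.
  - nra.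
  - rewrite Cmod_mult. pose proof (Cmod_ge_0 (F' u)).
    apply Rle_trans with (B * exp B)%R; [apply Rmult_le_compat; lra | nra].
  - intros h Hh. specialize (H3 h Hh).
    set (r := F (u + h) - F u - h * F' u) in *.
    set (d := h * F' u + r).
    replace (F (u + h)) with (F u + d) by (unfold d, r; ring).
    rewrite Cexp_plus.
    replace (Cexp (F u) * Cexp d - Cexp (F u) - h * (F' u * Cexp (F u)))
      with (Cexp (F u) * ((Cexp d - 1 - d) + r)) by (unfold d; ring).
    pose proof (Cmod_ge_0 h) as Qh. pose proof (Cmod_ge_0 r) as Qr.
    assert (Hd : (Cmod d <= 2 * B * Cmod h)%R).
    { unfold d. eapply Rle_trans; [apply Cmod_triangle|]. rewrite Cmod_mult.
      assert (B * Cmod h ^ 2 <= B * Cmod h)%R by (apply Rmult_le_compat_l; nra). nra. }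
    pose proof (Cmod_ge_0 d) as Qd.
    assert (T : (Cmod (Cexp d - 1 - d) <= 12 * B ^ 2 * exp (2 * B) * Cmod h ^ 2)%R).
    { eapply Rle_trans; [apply Cexp_taylor|].
      apply Rle_trans with (3 * (2 * B * Cmod h) ^ 2 * exp (2 * B))%R; [|right; ring].
      apply Rmult_le_compat; [nra | left; apply exp_pos | |].
      - apply Rmult_le_compat_l; [lra|]. apply pow_incr; lra.
      - apply exp_le_compat. nra. }
    rewrite Cmod_mult, Rmult_assoc. apply Rmult_le_compat; try apply Cmod_ge_0; [lra|].
    eapply Rle_trans; [apply Cmod_triangle|]. nra.
Qed.

Lemma entire_affine (F : C -> C) (c d : C) :
  entire F -> entire (fun z => F (c * z + d)).
Proof.
  intros [F' HF]. exists (fun z => c * F' (c * z + d)). intros M.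
  (* The radius covers the images of both u and u + h, the latter being required when |c h| > 1. *)
  destruct (taylor_bound_pos _ _ HF (Cmod c * (M + 1) + Cmod d)%R) as [B [P HB]].
  pose proof (Cmod_ge_0 c) as Qc.
  exists (3 * B * (1 + Cmod c) ^ 2)%R. intros u Hu.
  assert (Hb : forall v, (Cmod v <= M + 1)%R ->
            (Cmod (c * v + d) <= Cmod c * (M + 1) + Cmod d)%R).
  { intros v Hv. eapply Rle_trans; [apply Cmod_triangle|]. rewrite Cmod_mult.
    apply Rplus_le_compat_r, Rmult_le_compat_l; lra. }
  destruct (HB _ (Hb u ltac:(lra))) as (H1 & H2 & H3).
  pose proof (Cmod_ge_0 (F' (c * u + d))) as Q'.
  assert (X : (1 <= (1 + Cmod c) ^ 2)%R) by nra.
  assert (Y : (Cmod c <= (1 + Cmod c) ^ 2)%R) by nra.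
  assert (Z : (Cmod c ^ 2 <= (1 + Cmod c) ^ 2)%R) by nra.
  repeat split.
  - nra.
  - rewrite Cmod_mult. apply Rle_trans with ((1 + Cmod c) ^ 2 * B)%R; [|nra].
    apply Rmult_le_compat; lra.
  - intros h Hh. pose proof (Cmod_ge_0 h) as Qh.
    replace (c * (u + h) + d) with (c * u + d + c * h) by ring.
    replace (h * (c * F' (c * u + d))) with (c * h * F' (c * u + d)) by ring.
    assert (Hch : (Cmod (c * h) ^ 2 <= (1 + Cmod c) ^ 2 * Cmod h ^ 2)%R).
    { rewrite Cmod_mult, Rpow_mult_distr. apply Rmult_le_compat_r; [apply pow2_ge_0|lra]. }
    destruct (Rle_lt_dec (Cmod (c * h)) 1) as [L|L].
    + specialize (H3 _ L). eapply Rle_trans; [exact H3|].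
      rewrite Rmult_assoc. nra.
    (* Here c h lies outside the range of the Taylor estimate of F. The two values are bounded by B
       each and the linear term by B |c h|, and all of this is at most 3 B |c h|^2 because |c h| >
       1. *)
    + assert (Hv : (Cmod (u + h) <= M + 1)%R).
      { eapply Rle_trans; [apply Cmod_triangle | lra]. }
      destruct (HB _ (Hb _ Hv)) as (K1 & _).
      replace (c * (u + h) + d) with (c * u + d + c * h) in K1 by ring.
      unfold Cminus.
      eapply Rle_trans; [apply Cmod_triangle|].
      eapply Rle_trans; [apply Rplus_le_compat_r, Cmod_triangle|].
      rewrite !Cmod_opp. rewrite (Cmod_mult (c * h)).
      assert (Cmod (c * h) <= Cmod (c * h) ^ 2)%R by nra.
      assert (Cmod (c * h) * Cmod (F' (c * u + d)%C) <= Cmod (c * h) ^ 2 * B)%R.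
      { apply Rmult_le_compat; try lra. }
      apply Rle_trans with (3 * B * Cmod (c * h) ^ 2)%R; [nra|].
      rewrite Rmult_assoc. nra.
Qed.

(** Termwise differentiation: the remainders of the terms are summable with the same majorant as the
    terms, so the remainder of the sum is again quadratic in h. *)
Lemma entire_ZSum (f f' : Z -> C -> C) :
  (forall M, exists K, forall n,
     taylor_bound (f n) (f' n) M (K * exp (- Rabs (IZR n)))) ->
  entire (fun z => ZSum (fun n => f n z)).
Proof.
  intros H. exists (fun z => ZSum (fun n => f' n z)). intros M.
  (* The bound at radius M + 1 only ensures summability at u + h; the final constant comes from
     [K]. *)
  destruct (H M) as [K HK]. destruct (H (M + 1)%R) as [K1 HK1].
  exists (K * (2 * exp_series))%R. intros u Hu.
  assert (D0 : Zdecay (fun n => f n u) K) by (intros n; apply (HK n u Hu)).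
  assert (D1 : Zdecay (fun n => f' n u) K) by (intros n; apply (HK n u Hu)).
  repeat split; [now apply ZSum_Cmod_le | now apply ZSum_Cmod_le |].
  intros h Hh.
  assert (D2 : Zdecay (fun n => f n (u + h)) K1).
  { intros n. apply (HK1 n). eapply Rle_trans; [apply Cmod_triangle | lra]. }
  assert (E : ZSum (fun n => f n (u + h)) - ZSum (fun n => f n u)
                - h * ZSum (fun n => f' n u)
              = ZSum (fun n => f n (u + h) + (-1 * f n u + - h * f' n u))).
  { rewrite (ZSum_plus _ _ _ _ D2
              (Zdecay_plus _ _ _ _ (Zdecay_scal (-1) _ _ D0) (Zdecay_scal (- h) _ _ D1))).
    rewrite (ZSum_plus _ _ _ _ (Zdecay_scal (-1) _ _ D0) (Zdecay_scal (- h) _ _ D1)).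
    rewrite (ZSum_scal (-1) _ _ D0), (ZSum_scal (- h) _ _ D1). ring. }
  rewrite E.
  replace (K * (2 * exp_series) * Cmod h ^ 2)%R
    with (K * Cmod h ^ 2 * (2 * exp_series))%R by ring.
  apply ZSum_Cmod_le. intros n.
  replace (f n (u + h) + (-1 * f n u + - h * f' n u))
    with (f n (u + h) - f n u - h * f' n u) by ring.
  destruct (HK n u Hu) as (_ & _ & H3). specialize (H3 h Hh). nra.
Qed.

(** * Gaussian series over the integers *)

Definition theta_term (al be : C) (n : Z) : C :=
  Cexp (al * RtoC (IZR n) ^ 2 + be * RtoC (IZR n)).

(** The common form of [theta1] and of the triple product series: signs (-1)^n enter as a summand
    [PI * Ci] of [be], and half-integral indices as a prefactor together with a shift of [be] by
    [al]. *)
Definition Theta (al be : C) : C := ZSum (theta_term al be).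

Lemma gauss_le (a b x : R) :
  (a < 0 -> a * x ^ 2 + b * x <= b ^ 2 / (4 * - a))%R.
Proof.
  intros Ha.
  assert (E : (b ^ 2 / (4 * - a) - (a * x ^ 2 + b * x)
           = - a * (x + b / (2 * a)) ^ 2)%R) by (field; lra).
  pose proof (pow2_ge_0 (x + b / (2 * a))) as K.
  assert (0 <= - a * (x + b / (2 * a)) ^ 2)%R by (apply Rmult_le_pos; lra). lra.
Qed.

Lemma Re_theta_exponent (al be : C) (n : Z) :
  Re (al * RtoC (IZR n) ^ 2 + be * RtoC (IZR n)) = (Re al * IZR n ^ 2 + Re be * IZR n)%R.
Proof. rewrite <- RtoC_pow, re_plus, !re_scal_r. reflexivity. Qed.

Lemma Cmod_theta_term (al be : C) (n : Z) (M : R) : (Cmod be <= M)%R ->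
  (Cmod (theta_term al be n) <= exp (Re al * Rabs (IZR n) ^ 2 + M * Rabs (IZR n)))%R.
Proof.
  intros HM. unfold theta_term. rewrite Cmod_Cexp, Re_theta_exponent.
  apply exp_le_compat. rewrite RPow_abs, (Rabs_pos_eq (_ ^ 2)) by apply pow2_ge_0.
  apply Rplus_le_compat_l. eapply Rle_trans; [apply Rle_abs|].
  rewrite Rabs_mult. apply Rmult_le_compat_r; [apply Rabs_pos|].
  pose proof (re_le_Cmod be). lra.
Qed.

(** Completing the square with linear coefficient M + 1 instead of M; the additional unit pays for
    the factor exp(-x). *)
Lemma gauss_exp_le (a M x : R) : (a < 0)%R ->
  (exp (a * x ^ 2 + M * x) <= exp ((M + 1) ^ 2 / (4 * - a)) * exp (- x))%R.
Proof.
  intros Ha. rewrite <- exp_plus. apply exp_le_compat.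
  pose proof (gauss_le a (M + 1) x Ha). lra.
Qed.

Lemma theta_term_decay (al be : C) : (Re al < 0)%R ->
  exists K, Zdecay (theta_term al be) K.
Proof.
  intros Ha. eexists. intros n.
  eapply Rle_trans; [apply (Cmod_theta_term al be n (Cmod be)); lra|].
  now apply gauss_exp_le.
Qed.

Lemma entire_Theta (al : C) : (Re al < 0)%R -> entire (Theta al).
Proof.
  intros Ha.
  apply (entire_ZSum (fun n be => theta_term al be n)
           (fun n be => RtoC (IZR n) * theta_term al be n)).
  (* The summand 3 in the exponent pays for (exp x)^3: one factor is the exponential in
     [Cexp_taylor], the other two dominate x^2. The leading 3 is the constant of [Cexp_taylor]. *)
  intros M. exists (3 * exp ((M + 3 + 1) ^ 2 / (4 * - Re al)))%R.
  intros n be Hbe.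
  set (x := Rabs (IZR n)).
  assert (Hx : (0 <= x)%R) by apply Rabs_pos.
  pose proof (gauss_exp_le (Re al) (M + 3) x Ha) as G.
  set (K := exp ((M + 3 + 1) ^ 2 / (4 * - Re al))) in *.
  pose proof (Cmod_theta_term al be n M Hbe) as HT. fold x in HT.
  set (E := exp (Re al * x ^ 2 + M * x)) in *.
  assert (HE : (0 < E)%R) by apply exp_pos.
  assert (G' : (E * (exp x * exp x * exp x) <= K * exp (- x))%R).
  { unfold E. rewrite <- !exp_plus. eapply Rle_trans; [|exact G].
    right. f_equal. ring. }
  pose proof (exp_ineq1_le x) as Ex.
  assert (Y1 : (1 <= exp x)%R) by lra.
  assert (Y2 : (exp x <= exp x * exp x)%R) by nra.
  assert (Y3 : (exp x * exp x <= exp x * exp x * exp x)%R) by nra.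
  assert (S1 : (1 <= exp x * exp x * exp x)%R) by lra.
  assert (S2 : (x <= exp x * exp x * exp x)%R) by lra.
  assert (S3 : (x ^ 2 * exp x <= exp x * exp x * exp x)%R).
  { apply Rmult_le_compat_r; [lra|]. nra. }
  pose proof (Cmod_ge_0 (theta_term al be n)) as QT.
  assert (Hn : Cmod (RtoC (IZR n)) = x) by apply Cmod_R.
  assert (Z1 : (E <= K * exp (- x))%R).
  { eapply Rle_trans; [|exact G']. rewrite <- (Rmult_1_r E) at 1.
    apply Rmult_le_compat_l; lra. }
  assert (Z2 : (E * x <= K * exp (- x))%R).
  { eapply Rle_trans; [|exact G']. apply Rmult_le_compat_l; lra. }
  assert (Z3 : (E * (x ^ 2 * exp x) <= K * exp (- x))%R).
  { eapply Rle_trans; [|exact G']. apply Rmult_le_compat_l; lra. }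
  repeat split.
  - lra.
  - rewrite Cmod_mult, Hn. apply Rle_trans with (x * E)%R; [|lra].
    apply Rmult_le_compat_l; auto.
  - intros h Hh. pose proof (Cmod_ge_0 h) as Qh.
    assert (EQ : theta_term al (be + h) n = theta_term al be n * Cexp (h * RtoC (IZR n))).
    { unfold theta_term. rewrite <- Cexp_plus. f_equal. ring. }
    rewrite EQ.
    replace (theta_term al be n * Cexp (h * RtoC (IZR n)) - theta_term al be n
              - h * (RtoC (IZR n) * theta_term al be n))
      with (theta_term al be n * (Cexp (h * RtoC (IZR n)) - 1 - h * RtoC (IZR n))) by ring.
    rewrite Cmod_mult.
    apply Rle_trans with (E * (3 * (Cmod h ^ 2 * x ^ 2) * exp x))%R.
    + apply Rmult_le_compat; auto using Cmod_ge_0.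
      eapply Rle_trans; [apply Cexp_taylor|]. rewrite Cmod_mult, Hn.
      rewrite Rpow_mult_distr. apply Rmult_le_compat_l.
      * apply Rmult_le_pos; [lra|]. apply Rmult_le_pos; apply pow2_ge_0.
      * apply exp_le_compat. nra.
    + pose proof (pow2_ge_0 (Cmod h)).
      replace (E * (3 * (Cmod h ^ 2 * x ^ 2) * exp x))%R
        with (3 * (E * (x ^ 2 * exp x)) * Cmod h ^ 2)%R by ring.
      apply Rmult_le_compat_r; lra.
Qed.

(** * Mean values of periodic functions *)

Definition periodic (H : C -> C) : Prop := forall z, H (z + PI) = H z.
Definition antiperiodic (F : C -> C) : Prop := forall z, F (z + PI) = - F z.

Definition node (N j : nat) : C := RtoC (INR j * (PI / INR N)).
Definition node_sum (N : nat) (H : C -> C) (u : C) : C :=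
  Csum (fun j => H (u + node N j)) N.
Definition mean (N : nat) (H : C -> C) (u : C) : C := / INR N * node_sum N H u.

(** Doubling makes successive meshes nested. The offset 2 gives at least 4 nodes, so that the step
    pi/N is at most 1 and Taylor estimates apply to it. *)
Definition dyadic (n : nat) : nat := (2 ^ (n + 2))%nat.
Definition mean_value (H : C -> C) : C :=
  Clim_seq (fun n => mean (dyadic n) H 0).

Lemma Csum_telescope (f : nat -> C) (n : nat) :
  Csum (fun k => f (S k) - f k) n = f n - f O.
Proof. induction n as [|n IH]; simpl; [ring|]. rewrite IH. ring. Qed.

Lemma Csum_rotate (f : nat -> C) (n : nat) :
  f n = f O -> Csum (fun k => f (S k)) n = Csum f n.
Proof. intros E. rewrite Csum_shift. simpl. rewrite E. ring. Qed.

Lemma node_0 (N : nat) : node N 0 = 0.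
Proof. unfold node. simpl. now rewrite Rmult_0_l. Qed.

Lemma node_S (N j : nat) : node N (S j) = node N j + RtoC (PI / INR N).
Proof. unfold node. rewrite <- RtoC_plus, S_INR. f_equal. ring. Qed.

Lemma INR_gt_0 (N : nat) : (0 < N)%nat -> (0 < INR N)%R.
Proof. apply (lt_INR 0). Qed.

Lemma node_N (N : nat) : (0 < N)%nat -> node N N = PI.
Proof. intros HN. apply INR_gt_0 in HN. unfold node. f_equal. field. lra. Qed.

Lemma Cmod_node (N j : nat) : (j <= N)%nat -> (0 < N)%nat -> (Cmod (node N j) <= PI)%R.
Proof.
  intros Hj HN. apply INR_gt_0 in HN. apply le_INR in Hj. pose proof PI_RGT_0.
  unfold node. rewrite Cmod_R, Rabs_pos_eq.
  - replace PI with (INR N * (PI / INR N))%R at 2 by (field; lra).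
    apply Rmult_le_compat_r; auto. apply Rlt_le, Rdiv_lt_0_compat; lra.
  - apply Rmult_le_pos; [apply pos_INR|]. apply Rlt_le, Rdiv_lt_0_compat; lra.
Qed.

Lemma step_bounds (N : nat) : (4 <= N)%nat -> (0 < PI / INR N <= 1)%R.
Proof.
  intros HN. apply le_INR in HN. simpl in HN.
  pose proof PI_RGT_0. pose proof PI_4. split.
  - apply Rdiv_lt_0_compat; lra.
  - apply (Rmult_le_reg_r (INR N)); [lra|].
    replace (PI / INR N * INR N)%R with PI by (field; lra). lra.
Qed.

Lemma Cmod_step (N : nat) : (4 <= N)%nat ->
  Cmod (RtoC (PI / INR N)) = (PI / INR N)%R.
Proof.
  intros HN. rewrite Cmod_R. apply Rabs_pos_eq.
  pose proof (step_bounds N HN). lra.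
Qed.

Lemma node_sum_diff_le (H H' : C -> C) (M B : R) (N : nat) (w h : C) :
  taylor_bound H H' M B -> (0 < N)%nat ->
  (Cmod w + PI <= M)%R -> (Cmod h <= 1)%R ->
  (Cmod (node_sum N H (w + h) - node_sum N H w - h * node_sum N H' w)
     <= INR N * (B * Cmod h ^ 2))%R.
Proof.
  intros HT HN Hw Hh. unfold node_sum.
  replace (Csum (fun j => H (w + h + node N j)) N - Csum (fun j => H (w + node N j)) N
            - h * Csum (fun j => H' (w + node N j)) N)
    with (Csum (fun j => H (w + node N j + h) + (-1 * H (w + node N j)
            + - h * H' (w + node N j))) N).
  2:{ rewrite Csum_plus, Csum_plus, !Csum_scal.
      rewrite (Csum_ext (fun j => H (w + h + node N j)) (fun j => H (w + node N j + h))).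
      - ring.
      - intros k _. f_equal. ring. }
  rewrite <- Rsum_const. apply Csum_Cmod. intros j Hj.
  replace (H (w + node N j + h) + (-1 * H (w + node N j) + - h * H' (w + node N j)))
    with (H (w + node N j + h) - H (w + node N j) - h * H' (w + node N j)) by ring.
  apply HT; auto.
  eapply Rle_trans; [apply Cmod_triangle|].
  pose proof (Cmod_node N j). specialize (H0 ltac:(lia) HN). lra.
Qed.

(** Moving by a full step pi/N permutes the nodes modulo the period and leaves the sum of H
    unchanged. Hence (pi/N) times the sum of H' equals a remainder of size N B (pi/N)^2, and the sum
    of H' is O(1) instead of O(N). *)
Lemma node_sum_derivative_le (H H' : C -> C) (M B : R) (N : nat) (w : C) :
  periodic H -> taylor_bound H H' M B -> (4 <= N)%nat -> (Cmod w + PI <= M)%R ->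
  (Cmod (node_sum N H' w) <= B * PI)%R.
Proof.
  intros HP HT HN Hw.
  pose proof (step_bounds N HN) as [D0 D1].
  assert (HN' : (0 < N)%nat) by lia.
  assert (PN : (0 < INR N)%R) by now apply INR_gt_0.
  pose proof (node_sum_diff_le H H' M B N w (RtoC (PI / INR N)) HT HN' Hw) as K.
  rewrite (Cmod_step N HN) in K. specialize (K D1).
  assert (E : node_sum N H (w + RtoC (PI / INR N)) = node_sum N H w).
  { unfold node_sum.
    rewrite <- (Csum_rotate (fun j => H (w + node N j))).
    - apply Csum_ext. intros j _. rewrite node_S. f_equal. ring.
    - rewrite node_N, node_0 by exact HN'. rewrite HP. f_equal. ring. }
  rewrite E in K.
  replace (node_sum N H w - node_sum N H w - RtoC (PI / INR N) * node_sum N H' w)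
    with (- (RtoC (PI / INR N) * node_sum N H' w)) in K by ring.
  rewrite Cmod_opp, Cmod_mult, (Cmod_step N HN) in K.
  apply (Rmult_le_reg_l (PI / INR N)); [lra|].
  eapply Rle_trans; [exact K|]. right. field. lra.
Qed.

(* Moving from [u] to [v] in [N] steps of length O(1/N), each step changes the
   sum of [H] by O(1/N): to first order the change is a sum of [H'], which
   almost telescopes over a period. This replaces contour shifting. *)
Lemma node_sum_shift_le (H : C -> C) (u v : C) :
  periodic H -> entire H -> exists K N0, forall N, (N0 <= N)%nat ->
  (Cmod (node_sum N H v - node_sum N H u) <= K)%R.
Proof.
  intros HP [H' HT].
  set (D := Cmod (v - u)).
  assert (HD : (0 <= D)%R) by apply Cmod_ge_0.
  destruct (taylor_bound_pos _ _ HT (Cmod u + D + PI)%R) as [B [PB HB]].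
  destruct (INR_unbounded D) as [N1 HN1].
  exists (D * (B * PI) + B * D ^ 2)%R, (4 + N1)%nat. intros N HN.
  assert (PN : (0 < INR N)%R) by (apply INR_gt_0; lia).
  assert (DN : (D <= INR N)%R).
  { assert (INR N1 <= INR N)%R by (apply le_INR; lia). lra. }
  set (h := (v - u) / INR N).
  assert (NN : RtoC (INR N) <> 0) by (intros E; apply RtoC_inj in E; lra).
  assert (Hh : Cmod h = (D / INR N)%R).
  { unfold h. rewrite Cmod_div, Cmod_R, Rabs_pos_eq; auto; lra. }
  assert (DN1 : (D / INR N <= 1)%R).
  { apply (Rmult_le_reg_r (INR N)); auto.
    replace (D / INR N * INR N)%R with D by (field; lra). lra. }
  assert (DN0 : (0 <= D / INR N)%R).
  { rewrite <- Hh. apply Cmod_ge_0. }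
  replace v with (u + INR N * h) by (unfold h; field; auto).
  replace (node_sum N H u) with (node_sum N H (u + INR O * h)).
  2:{ f_equal. simpl. ring. }
  rewrite <- (Csum_telescope (fun k => node_sum N H (u + INR k * h))).
  replace (D * (B * PI) + B * D ^ 2)%R
    with (INR N * (D / INR N * (B * PI) + INR N * (B * (D / INR N) ^ 2)))%R
    by (field; lra).
  rewrite <- (Rsum_const _ N). apply Csum_Cmod. intros k Hk.
  set (w := u + INR k * h).
  replace (u + INR (S k) * h) with (w + h) by (unfold w; rewrite S_INR, RtoC_plus; ring).
  assert (Hw : (Cmod w + PI <= Cmod u + D + PI)%R).
  { apply Rplus_le_compat_r. unfold w. eapply Rle_trans; [apply Cmod_triangle|].
    apply Rplus_le_compat_l. rewrite Cmod_mult, Hh, Cmod_R, Rabs_pos_eq by apply pos_INR.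
    replace D with (INR N * (D / INR N))%R at 2 by (field; lra).
    apply Rmult_le_compat_r; auto. apply le_INR; lia. }
  pose proof (node_sum_derivative_le H H' _ B N w HP HB ltac:(lia) Hw) as K1.
  pose proof (node_sum_diff_le H H' _ B N w h HB ltac:(lia) Hw) as K2.
  rewrite Hh in K2. specialize (K2 DN1).
  replace (node_sum N H (w + h) - node_sum N H w)
    with (h * node_sum N H' w + (node_sum N H (w + h) - node_sum N H w - h * node_sum N H' w))
    by ring.
  eapply Rle_trans; [apply Cmod_triangle|]. apply Rplus_le_compat; [|exact K2].
  rewrite Cmod_mult, Hh. apply Rmult_le_compat_l; auto.
Qed.

Lemma dyadic_ge_4 (n : nat) : (4 <= dyadic n)%nat.
Proof.
  unfold dyadic. rewrite Nat.pow_add_r. simpl.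
  pose proof (Nat.pow_nonzero 2 n). lia.
Qed.

Lemma dyadic_S (n : nat) : dyadic (S n) = (2 * dyadic n)%nat.
Proof. reflexivity. Qed.

Lemma dyadic_ge_id (n : nat) : (n <= dyadic n)%nat.
Proof.
  induction n as [|n IH]; [lia|]. rewrite dyadic_S.
  pose proof (dyadic_ge_4 n). lia.
Qed.

Lemma INR_dyadic (n : nat) : INR (dyadic n) = (4 * 2 ^ n)%R.
Proof.
  induction n as [|n IH]; [unfold dyadic; simpl; ring|].
  rewrite dyadic_S, mult_INR, IH. simpl. ring.
Qed.

Lemma Csum_even_odd (f : nat -> C) (n : nat) :
  Csum f (2 * n) = Csum (fun k => f (2 * k)%nat) n + Csum (fun k => f (2 * k + 1)%nat) n.
Proof.
  induction n as [|n IH]; [simpl; ring|].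
  replace (2 * S n)%nat with (S (S (2 * n))) by lia.
  cbn [Csum]. rewrite IH. replace (S (2 * n)) with (2 * n + 1)%nat by lia. ring.
Qed.

(** Even nodes of the fine mesh are the coarse nodes; odd nodes are the coarse nodes moved by half a
    coarse step. *)
Lemma node_sum_double (N : nat) (H : C -> C) (u : C) : (0 < N)%nat ->
  node_sum (2 * N) H u = node_sum N H u + node_sum N H (u + RtoC (PI / INR (2 * N))).
Proof.
  intros HN. apply INR_gt_0 in HN. unfold node_sum. rewrite Csum_even_odd. f_equal.
  - apply Csum_ext. intros k _. do 2 f_equal. unfold node. f_equal.
    rewrite !mult_INR. simpl. field. lra.
  - apply Csum_ext. intros k _. f_equal.
    rewrite <- Cplus_assoc. f_equal. unfold node. rewrite <- RtoC_plus. f_equal.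
    rewrite plus_INR, !mult_INR. simpl. field. lra.
Qed.

Lemma is_lim_seq_div_pow2 (K : R) : is_lim_seq (fun n => K / 2 ^ n)%R 0%R.
Proof.
  replace 0%R with (K * 0)%R by ring.
  apply (is_lim_seq_ext (fun n => K * (/ 2) ^ n)%R).
  - intros n. rewrite pow_inv. reflexivity.
  - apply (is_lim_seq_scal_l _ K 0%R). apply is_lim_seq_geom.
    rewrite Rabs_pos_eq; lra.
Qed.

Lemma Cmod_mean_le (N : nat) (x : C) (K : R) : (0 < N)%nat ->
  (Cmod x <= K -> Cmod (/ INR N * x) <= K / INR N)%R.
Proof.
  intros HN HK. apply INR_gt_0 in HN.
  rewrite Cmod_mult, Cmod_inv, Cmod_R, Rabs_pos_eq; try lra.
  - unfold Rdiv. rewrite Rmult_comm. apply Rmult_le_compat_r; auto.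
    left. now apply Rinv_0_lt_compat.
  - intros E; apply RtoC_inj in E; lra.
Qed.

(** Consecutive means differ by a term of a geometric series, so the sequence of means is a
    telescoping convergent series. *)
Lemma mean_cvg_0 (H : C -> C) : periodic H -> entire H ->
  Ccvg (fun n => mean (dyadic n) H 0) (mean_value H).
Proof.
  intros HP [H' HT].
  destruct (taylor_bound_pos _ _ HT PI) as [B [PB HB]].
  set (a := fun n => mean (dyadic (S n)) H 0 - mean (dyadic n) H 0).
  assert (Ha : forall n, (Cmod (a n) <= B * (/ 2) ^ n)%R).
  { intros n. pose proof (dyadic_ge_4 n) as D4. unfold a, mean.
    rewrite dyadic_S, node_sum_double by lia.
    set (N := dyadic n) in *. set (d := RtoC (PI / INR (2 * N))).
    assert (PN : (0 < INR N)%R) by (apply INR_gt_0; lia).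
    assert (HN : RtoC (INR N) <> 0) by (intros E; apply RtoC_inj in E; lra).
    assert (E2 : RtoC (INR (2 * N)) = 2 * INR N).
    { rewrite mult_INR. simpl. now rewrite RtoC_mult. }
    replace (/ INR (2 * N) * (node_sum N H 0 + node_sum N H (0 + d)) - / INR N * node_sum N H 0)
      with (/ INR (2 * N) * (node_sum N H (0 + d) - node_sum N H 0)).
    2:{ rewrite E2. field. exact HN. }
    assert (HT0 : (Cmod 0 + PI <= PI)%R) by (rewrite Cmod_0; lra).
    pose proof (node_sum_derivative_le H H' PI B N 0 HP HB D4 HT0) as K1.
    assert (Hd : (Cmod d <= 1)%R).
    { unfold d. rewrite Cmod_step by lia. apply step_bounds. lia. }
    pose proof (node_sum_diff_le H H' PI B N 0 d HB ltac:(lia) HT0 Hd) as K2.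
    assert (Hd' : Cmod d = (PI / (2 * INR N))%R).
    { unfold d. rewrite Cmod_step by lia. rewrite mult_INR. reflexivity. }
    pose proof PI_4 as P4. pose proof PI_RGT_0 as P0.
    (* The first-order term is at most B pi <= 4 B and the remainder at most 4 B. With 2N = 8 * 2^n
       the quotient is exactly B / 2^n. *)
    apply Rle_trans with (2 * B * 4 / INR (2 * N))%R.
    - apply Cmod_mean_le; [lia|].
      replace (node_sum N H (0 + d) - node_sum N H 0)
        with (d * node_sum N H' 0 + (node_sum N H (0 + d) - node_sum N H 0 - d * node_sum N H' 0))
        by ring.
      eapply Rle_trans; [apply Cmod_triangle|].
      rewrite Cmod_mult. pose proof (Cmod_ge_0 d).
      assert (Cmod d * Cmod (node_sum N H' 0) <= 1 * (B * PI))%R.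
      { apply Rmult_le_compat; auto using Cmod_ge_0. }
      assert (INR N * (B * Cmod d ^ 2) <= B * 4)%R.
      { replace (INR N * (B * Cmod d ^ 2))%R with (B * (INR N * Cmod d * Cmod d))%R by ring.
        apply Rmult_le_compat_l; auto.
        assert (INR N * Cmod d <= 4)%R.
        { rewrite Hd'. replace (INR N * (PI / (2 * INR N)))%R with (PI / 2)%R by (field; lra). lra. }
        assert (0 <= INR N * Cmod d)%R by (apply Rmult_le_pos; lra). nra. }
      nra.
    - rewrite mult_INR. unfold N. rewrite INR_dyadic, pow_inv. simpl INR.
      pose proof (pow_lt 2 n ltac:(lra)).
      right. field. lra. }
  assert (Da : dominated a (fun n => B * (/ 2) ^ n)%R).
  { split; auto. apply (ex_series_scal_l B (fun n => (/ 2) ^ n)%R).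
    apply ex_series_geom. rewrite Rabs_pos_eq; lra. }
  pose proof (CSeries_cvg _ _ Da) as Hc.
  assert (Hl : Ccvg (fun n => mean (dyadic n) H 0) (CSeries a + mean (dyadic 0) H 0)).
  { apply Ccvg_ext with (fun n => Csum a n + mean (dyadic 0) H 0).
    - intros n. unfold a. rewrite (Csum_telescope (fun n => mean (dyadic n) H 0)). ring.
    - apply Ccvg_plus; [exact Hc | apply Ccvg_const]. }
  unfold mean_value. rewrite (Clim_seq_Ccvg _ _ Hl). exact Hl.
Qed.

(** A change of base point alters the node sum by a bounded amount, hence the mean by O(1/N): the
    limit is the same from every complex base point. *)
Lemma mean_cvg (H : C -> C) (u : C) : periodic H -> entire H ->
  Ccvg (fun n => mean (dyadic n) H u) (mean_value H).
Proof.
  intros HP HE.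
  destruct (node_sum_shift_le H 0 u HP HE) as [K [N0 HK]].
  apply Ccvg_ext with
    (fun n => mean (dyadic n) H 0 + (mean (dyadic n) H u - mean (dyadic n) H 0)).
  { intros n. ring. }
  rewrite <- (Cplus_0_r (mean_value H)).
  apply Ccvg_plus; [now apply mean_cvg_0|].
  apply Ccvg_spec. intros eps He.
  pose proof (is_lim_seq_div_pow2 K) as L. apply is_lim_seq_spec in L.
  destruct (L (mkposreal eps He)) as [N1 HN1]. simpl in HN1.
  exists (N0 + N1)%nat. intros n Hn.
  pose proof (dyadic_ge_id n). pose proof (dyadic_ge_4 n).
  specialize (HN1 n ltac:(lia)). rewrite Rminus_0_r in HN1.
  specialize (HK (dyadic n) ltac:(lia)).
  pose proof (Cmod_ge_0 (node_sum (dyadic n) H u - node_sum (dyadic n) H 0)) as Q.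
  unfold mean.
  replace (/ INR (dyadic n) * node_sum (dyadic n) H u - / INR (dyadic n) * node_sum (dyadic n) H 0 - 0)
    with (/ INR (dyadic n) * (node_sum (dyadic n) H u - node_sum (dyadic n) H 0)) by ring.
  pose proof (pow_lt 2 n ltac:(lra)) as Pw.
  eapply Rle_lt_trans; [apply Cmod_mean_le; [lia | exact HK]|].
  rewrite INR_dyadic.
  apply Rle_lt_trans with (K / 2 ^ n)%R.
  - unfold Rdiv. apply Rmult_le_compat_l; [lra|]. apply Rinv_le_contravar; lra.
  - eapply Rle_lt_trans; [apply Rle_abs | exact HN1].
Qed.

(** * Fourier coefficients *)

Definition harmonic (m : Z) (z : C) : C := Cexp (Ci * IZR m * z).
(** For odd [m] the harmonic is antiperiodic, so twisting an antiperiodic function yields period pi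
    and mean values become applicable. *)
Definition twist (m : Z) (F : C -> C) (z : C) : C := F z * harmonic (- m) z.
Definition coef (m : Z) (F : C -> C) : C := mean_value (twist m F).

Lemma harmonic_plus (m : Z) (z w : C) :
  harmonic m (z + w) = harmonic m z * harmonic m w.
Proof. unfold harmonic. rewrite <- Cexp_plus. f_equal. ring. Qed.

Lemma harmonic_plus_Z (m p : Z) (z : C) :
  harmonic (m + p) z = harmonic m z * harmonic p z.
Proof.
  unfold harmonic. rewrite <- Cexp_plus, plus_IZR, RtoC_plus. f_equal. ring.
Qed.

Lemma harmonic_opp (m : Z) (z : C) : harmonic (- m) z * harmonic m z = 1.
Proof.
  rewrite <- harmonic_plus_Z. unfold harmonic. rewrite Z.add_opp_diag_l.
  replace (Ci * 0 * z) with (RtoC 0) by ring. apply Cexp_0.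
Qed.

Lemma harmonic_neq_0 (m : Z) (z : C) : harmonic m z <> 0.
Proof. apply Cexp_neq_0. Qed.

Lemma harmonic_opp_arg (m : Z) (z : C) : harmonic m (- z) = harmonic (- m) z.
Proof. unfold harmonic. rewrite opp_IZR, RtoC_opp. f_equal. ring. Qed.

Lemma harmonic_PI (m : Z) : Z.odd m = true -> harmonic m PI = -1.
Proof.
  intros Hm. rewrite (Z.odd_spec m) in Hm. destruct Hm as [k ->].
  unfold harmonic.
  replace (Ci * IZR (2 * k + 1) * PI) with (2 * PI * Ci * IZR k + PI * Ci).
  - rewrite Cexp_plus, Cexp_2PI_Z, Cexp_PI. ring.
  - rewrite plus_IZR, mult_IZR, RtoC_plus, RtoC_mult. ring.
Qed.

Lemma entire_harmonic (m : Z) : entire (harmonic m).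
Proof. apply entire_exp, entire_scal, entire_id. Qed.

Lemma entire_twist (m : Z) (F : C -> C) : entire F -> entire (twist m F).
Proof. intros H. apply entire_mult; [exact H | apply entire_harmonic]. Qed.

Lemma periodic_twist (m : Z) (F : C -> C) :
  Z.odd m = true -> antiperiodic F -> periodic (twist m F).
Proof.
  intros Hm HF z. unfold twist.
  rewrite HF, harmonic_plus, (harmonic_PI (- m)); [ring|].
  now rewrite Z.odd_opp.
Qed.

Lemma node_sum_ext (N : nat) (F G : C -> C) (u v : C) :
  (forall j, (j < N)%nat -> F (u + node N j) = G (v + node N j)) ->
  node_sum N F u = node_sum N G v.
Proof. apply Csum_ext. Qed.

Lemma node_sum_scal (N : nat) (c : C) (F : C -> C) (u : C) :
  node_sum N (fun z => c * F z) u = c * node_sum N F u.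
Proof. apply Csum_scal. Qed.

Lemma coef_cvg (m : Z) (F : C -> C) (u : C) :
  Z.odd m = true -> antiperiodic F -> entire F ->
  Ccvg (fun n => mean (dyadic n) (twist m F) u) (coef m F).
Proof.
  intros Hm HP HE. apply mean_cvg; [now apply periodic_twist | now apply entire_twist].
Qed.

Lemma coef_comb (m : Z) (a b : C) (F G : C -> C) : Z.odd m = true ->
  antiperiodic F -> entire F -> antiperiodic G -> entire G ->
  coef m (fun z => a * F z + b * G z) = a * coef m F + b * coef m G.
Proof.
  intros Hm HF EF HG EG. apply Clim_seq_Ccvg.
  apply Ccvg_ext with (fun n => a * mean (dyadic n) (twist m F) 0 +
                                b * mean (dyadic n) (twist m G) 0).
  - intros n. unfold mean. 
    replace (node_sum (dyadic n) (twist m (fun z => a * F z + b * G z)) 0)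
      with (a * node_sum (dyadic n) (twist m F) 0 + b * node_sum (dyadic n) (twist m G) 0).
    + ring.
    + unfold node_sum. rewrite <- !Csum_scal, <- Csum_plus. apply Csum_ext.
      intros k _. unfold twist. ring.
  - apply Ccvg_plus; apply Ccvg_scal; now apply coef_cvg.
Qed.

(** The coefficient of index m is computed from the base point [s]; the functional equation turns
    those samples into samples of the twist by m + 2p at base point 0. *)
Lemma coef_quasi_periodic (m p : Z) (s b : C) (F : C -> C) : Z.odd m = true ->
  antiperiodic F -> entire F ->
  (forall z, F (z + s) = b * harmonic (- (2 * p)) z * F z) ->
  coef m F = b * harmonic (- m) s * coef (m + 2 * p) F.
Proof.
  intros Hm HP HE HQ.
  apply (Ccvg_unique (fun n => mean (dyadic n) (twist m F) s)).
  - now apply coef_cvg.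
  - apply Ccvg_ext with
      (fun n => b * harmonic (- m) s * mean (dyadic n) (twist (m + 2 * p) F) 0).
    + intros n. unfold mean.
      replace (node_sum (dyadic n) (twist m F) s)
        with (b * harmonic (- m) s * node_sum (dyadic n) (twist (m + 2 * p) F) 0); [ring|].
      rewrite <- node_sum_scal. apply node_sum_ext. intros j _.
      set (x := node (dyadic n) j). unfold twist.
      rewrite Cplus_0_l, (Cplus_comm s x), HQ, Z.opp_add_distr, harmonic_plus_Z.
      rewrite harmonic_plus. ring.
    + apply Ccvg_scal. apply coef_cvg; auto.
      rewrite Z.odd_add_mul_2. exact Hm.
Qed.

Lemma Csum_rev (f : nat -> C) (n : nat) :
  Csum (fun k => f (n - 1 - k)%nat) n = Csum f n.
Proof.
  induction n as [|n IH]; [reflexivity|].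
  replace (Csum f (S n)) with (Csum f n + f n) by reflexivity.
  rewrite <- IH.
  assert (E : Csum (fun k => f (S n - 1 - S k)%nat) n
             = Csum (fun k => f (S n - 1 - k)%nat) (S n) - f (S n - 1 - 0)%nat).
  { apply (Csum_shift (fun k => f (S n - 1 - k)%nat)). }
  replace (f n) with (f (S n - 1 - 0)%nat) by (f_equal; lia).
  rewrite (Csum_ext (fun k => f (n - 1 - k)%nat) (fun k => f (S n - 1 - S k)%nat)).
  2:{ intros k _. f_equal. lia. }
  rewrite E. ring.
Qed.

(** The map x -> pi - x permutes the nodes modulo pi, and under it the twist by m becomes minus the
    twist by -m. *)
Lemma coef_odd (m : Z) (F : C -> C) : Z.odd m = true ->
  antiperiodic F -> entire F -> (forall z, F (- z) = - F z) ->
  coef (- m) F = - coef m F.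
Proof.
  intros Hm HP HE HO. apply Clim_seq_Ccvg.
  apply Ccvg_ext with (fun n => -1 * mean (dyadic n) (twist m F) 0).
  2:{ replace (- coef m F) with (-1 * coef m F) by ring.
      apply Ccvg_scal. now apply coef_cvg. }
  intros n. pose proof (dyadic_ge_4 n) as D4. set (N := dyadic n) in *.
  assert (PT := periodic_twist m F Hm HP).
  unfold mean.
  replace (node_sum N (twist (- m) F) 0) with (-1 * node_sum N (twist m F) 0); [ring|].
  unfold node_sum.
  (* Rotating by one index and then reversing lists the nodes as pi - x_j. *)
  rewrite <- (Csum_rotate (fun j => twist m F (0 + node N j))).
  2:{ rewrite node_N, node_0 by lia. rewrite PT. f_equal. ring. }
  rewrite <- (Csum_rev (fun j => twist m F (0 + node N (S j)))).
  rewrite <- Csum_scal. apply Csum_ext. intros j Hj.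
  replace (node N (S (N - 1 - j))) with (- node N j + PI).
  2:{ replace (S (N - 1 - j)) with (N - j)%nat by lia.
      rewrite <- (node_N N) by lia. unfold node.
      rewrite <- RtoC_opp, <- RtoC_plus, minus_INR by lia. f_equal. ring. }
  rewrite !Cplus_0_l, PT. unfold twist.
  rewrite HO, harmonic_opp_arg. ring.
Qed.

(** * The discrete Fourier transform at odd frequencies *)

Definition dft (N : nat) (m : Z) (F : C -> C) (u : C) : C :=
  / INR N * Csum (fun j => F (u + node N j) * harmonic (- m) (node N j)) N.

(** In [dft] the harmonic is sampled at the real nodes alone, where it has modulus 1; this makes
    size estimates uniform in m. The price is the factor [harmonic m u], independent of N. *)
Lemma dft_mean (N : nat) (m : Z) (F : C -> C) (u : C) :
  dft N m F u = harmonic m u * mean N (twist m F) u.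
Proof.
  unfold dft, mean.
  replace (Csum (fun j => F (u + node N j) * harmonic (- m) (node N j)) N)
    with (harmonic m u * node_sum N (twist m F) u); [ring|].
  unfold node_sum. rewrite <- Csum_scal. apply Csum_ext. intros j _.
  unfold twist. rewrite harmonic_plus.
  replace (harmonic m u * (F (u + node N j) * (harmonic (- m) u * harmonic (- m) (node N j))))
    with (harmonic (- m) u * harmonic m u * (F (u + node N j) * harmonic (- m) (node N j)))
    by ring.
  rewrite harmonic_opp. ring.
Qed.

Definition odd_Z (k : nat) : Z := (2 * Z.of_nat k + 1)%Z.

Lemma odd_odd_Z (k : nat) : Z.odd (odd_Z k) = true.
Proof. unfold odd_Z. rewrite Z.add_comm. apply (Z.odd_add_mul_2 1). Qed.

Lemma IZR_odd_Z (k : nat) : IZR (odd_Z k) = (2 * INR k + 1)%R.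
Proof. unfold odd_Z. now rewrite plus_IZR, mult_IZR, <- INR_IZR_INZ. Qed.

Lemma harmonic_R (m : Z) (x : R) :
  harmonic m x = (cos (IZR m * x), sin (IZR m * x)).
Proof.
  unfold harmonic, Cexp, Ci, RtoC, Cmult, Re, Im; cbn [fst snd].
  replace ((0 * IZR m - 1 * 0) * x - (0 * 0 + 1 * IZR m) * 0)%R with 0%R by ring.
  replace ((0 * IZR m - 1 * 0) * 0 + (0 * 0 + 1 * IZR m) * x)%R with (IZR m * x)%R by ring.
  rewrite exp_0. f_equal; ring.
Qed.

Lemma Cmod_harmonic_R (m : Z) (x : R) : Cmod (harmonic m x) = 1%R.
Proof.
  unfold harmonic. rewrite Cmod_Cexp, re_scal_r, <- exp_0. f_equal.
  rewrite re_scal_r. unfold Re, Ci; simpl. ring.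
Qed.

Lemma harmonic_opp_plus (m : Z) (x : R) :
  harmonic (- m) x + harmonic m x = RtoC (2 * cos (IZR m * x)).
Proof.
  rewrite !harmonic_R, opp_IZR.
  replace (- IZR m * x)%R with (- (IZR m * x))%R by ring.
  rewrite cos_neg, sin_neg. unfold Cplus, RtoC; simpl. f_equal; ring.
Qed.

(** Dirichlet kernel of the odd frequencies: 2 sin x cos((2k+1)x) = sin((2k+2)x) - sin(2kx)
    telescopes. *)
Lemma sin_mul_Csum_harmonic (M : nat) (x : R) :
  RtoC (sin x) * Csum (fun k => harmonic (- odd_Z k) x + harmonic (odd_Z k) x) M
    = RtoC (sin (INR (2 * M) * x)).
Proof.
  induction M as [|M IH].
  - simpl. rewrite Rmult_0_l, sin_0. ring.
  - cbn [Csum]. rewrite Cmult_plus_distr_l, IH, harmonic_opp_plus.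
    rewrite <- RtoC_mult, <- RtoC_plus. f_equal.
    rewrite IZR_odd_Z.
    set (y := ((2 * INR M + 1) * x)%R).
    replace (INR (2 * M) * x)%R with (y - x)%R
      by (unfold y; rewrite mult_INR; simpl (INR 2); ring).
    replace (INR (2 * S M) * x)%R with (y + x)%R
      by (unfold y; rewrite mult_INR, (S_INR M); simpl (INR 2); ring).
    rewrite sin_minus, sin_plus. ring.
Qed.

Lemma sin_nat_PI (n : nat) : sin (INR n * PI) = 0%R.
Proof.
  apply sin_eq_0_1. exists (Z.of_nat n). now rewrite <- INR_IZR_INZ.
Qed.

(** After exchanging the sums, sample j is weighted by the Dirichlet kernel at j pi/N. For 0 < j < N
    the kernel vanishes, since sin(N j pi/N) = 0 while sin(j pi/N) > 0; at j = 0 it equals N. *)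
Lemma dft_inversion (M : nat) (F : C -> C) (u : C) : (0 < M)%nat ->
  Csum (fun k => dft (2 * M) (odd_Z k) F u + dft (2 * M) (- odd_Z k) F u) M = F u.
Proof.
  intros HM. set (N := (2 * M)%nat).
  assert (PN : (0 < INR N)%R) by (apply INR_gt_0; lia).
  assert (NN : RtoC (INR N) <> 0) by (intros E; apply RtoC_inj in E; lra).
  unfold dft.
  rewrite (Csum_ext _ (fun k => Csum (fun j => / INR N * (F (u + node N j) *
     (harmonic (- odd_Z k) (node N j) + harmonic (odd_Z k) (node N j)))) N)).
  2:{ intros k _. rewrite Z.opp_involutive, <- Cmult_plus_distr_l, <- Csum_plus, <- Csum_scal.
      apply Csum_ext. intros j _. ring. }
  rewrite Csum_exchange.
  rewrite (Csum_ext _ (fun j => / INR N * F (u + node N j) *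
     Csum (fun k => harmonic (- odd_Z k) (node N j) + harmonic (odd_Z k) (node N j)) M)).
  2:{ intros j _. rewrite <- Csum_scal. apply Csum_ext. intros k _. ring. }
  assert (Z : forall j, (0 < j < N)%nat ->
    Csum (fun k => harmonic (- odd_Z k) (node N j) + harmonic (odd_Z k) (node N j)) M = 0).
  { intros j [J0 J1]. apply INR_gt_0 in J0. apply lt_INR in J1.
    pose proof PI_RGT_0 as P0.
    assert (S : (0 < sin (INR j * (PI / INR N)))%R).
    { assert (0 < PI / INR N)%R by (apply Rdiv_lt_0_compat; lra).
      apply sin_gt_0; [apply Rmult_lt_0_compat; lra|].
      replace PI with (INR N * (PI / INR N))%R at 2 by (field; lra).
      apply Rmult_lt_compat_r; lra. }
    pose proof (sin_mul_Csum_harmonic M (INR j * (PI / INR N))) as K.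
    fold N in K.
    replace (INR N * (INR j * (PI / INR N)))%R with (INR j * PI)%R in K by (field; lra).
    rewrite sin_nat_PI in K.
    destruct (Ceq_dec (Csum (fun k => harmonic (- odd_Z k) (node N j) + harmonic (odd_Z k) (node N j)) M) 0)
      as [E|E]; [exact E|].
    exfalso. refine (Cmult_neq_0 _ _ _ E K).
    intros E'; apply RtoC_inj in E'; lra. }
  assert (Gen : forall n, (1 <= n <= N)%nat ->
    Csum (fun j => / INR N * F (u + node N j) *
     Csum (fun k => harmonic (- odd_Z k) (node N j) + harmonic (odd_Z k) (node N j)) M) n
     = F u).
  { intros n Hn. induction n as [|n IH]; [lia|]. cbn [Csum].
    destruct n as [|n].
    - cbn [Csum]. rewrite node_0, Cplus_0_r.
      rewrite (Csum_ext _ (fun _ => 2)).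
      2:{ intros k _. unfold harmonic. rewrite !Cmult_0_r, Cexp_0. ring. }
      rewrite Csum_const.
      replace (RtoC (INR M) * 2) with (RtoC (INR N)).
      + field. exact NN.
      + unfold N. rewrite mult_INR, RtoC_mult. simpl (INR 2).
        rewrite RtoC_plus. ring.
    - rewrite IH by lia. rewrite (Z (S n)) by lia. ring. }
  apply Gen. lia.
Qed.

(** 2 - 2 cos x = 4 sin^2(x/2), and sin y >= y/3 for y = x/2 <= 2, so that 4 (x/6)^2 = x^2/9. *)
Lemma cos_gap_le (x : R) : (0 <= x <= PI)%R -> (x ^ 2 / 9 <= 2 - 2 * cos x)%R.
Proof.
  intros [H0 H1]. pose proof PI_4 as P4.
  replace x with (2 * (x / 2))%R at 2 by field. rewrite cos_2a_sin.
  pose proof (sin_ge_cubic (x / 2) ltac:(lra)) as K.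
  assert (x / 2 / 3 <= sin (x / 2))%R.
  { assert (x / 2 <= 2)%R by lra. set (y := (x / 2)%R) in *.
    assert (0 <= y)%R by (unfold y; lra).
    assert (y ^ 3 / 6 <= y * 2 / 3)%R by nra. lra. }
  nra.
Qed.

(** Discrete integration by parts, twice: a second difference of the samples multiplies the
    coefficient by -(2 - 2 cos(md)), while the Taylor estimate bounds the second difference by 2 B
    d^2. The condition 2k + 1 <= N keeps md within [0, pi], where [cos_gap_le] applies; 18 = 2 *
    9. *)
Lemma dft_le (F F' : C -> C) (u : C) (B : R) (N k : nat) :
  antiperiodic F -> taylor_bound F F' (Cmod u + 8) B -> (4 <= N)%nat ->
  (2 * k + 1 <= N)%nat -> forall m, m = odd_Z k \/ m = (- odd_Z k)%Z ->
  (Cmod (dft N m F u) <= 18 * B / (2 * INR k + 1) ^ 2)%R.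
Proof.
  intros HP HT HN Hk m Hm.
  pose proof (step_bounds N HN) as [D0 D1]. set (d := (PI / INR N)%R) in *.
  assert (HN' : (0 < N)%nat) by lia.
  assert (PN : (0 < INR N)%R) by now apply INR_gt_0.
  assert (Hodd : Z.odd (- m) = true).
  { rewrite Z.odd_opp. destruct Hm as [->| ->]; rewrite ?Z.odd_opp; apply odd_odd_Z. }
  set (mm := (2 * INR k + 1)%R).
  assert (Pm : (0 < mm)%R) by (unfold mm; pose proof (pos_INR k); lra).
  assert (Hcos : cos (IZR (- m) * d) = cos (mm * d)).
  { destruct Hm as [->| ->]; rewrite ?Z.opp_involutive, ?opp_IZR, IZR_odd_Z; fold mm.
    - rewrite <- cos_neg. f_equal. ring.
    - reflexivity. }
  set (g := fun j => F (u + node N j) * harmonic (- m) (node N j)).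
  (* Both factors change sign over a period, so the product is periodic and index shifts by one or
     two preserve its sum over N nodes. *)
  assert (g_per : forall j, g (N + j)%nat = g j).
  { intros j. unfold g. replace (node N (N + j)) with (node N j + PI).
    - rewrite Cplus_assoc, HP, harmonic_plus, (harmonic_PI _ Hodd). ring.
    - rewrite <- (node_N N HN'). unfold node. rewrite <- RtoC_plus, plus_INR.
      f_equal. ring. }
  set (S := Csum g N).
  assert (E1 : Csum (fun j => g (Datatypes.S j)) N = S).
  { apply Csum_rotate. pose proof (g_per 0%nat) as K. now rewrite Nat.add_0_r in K. }
  assert (E2 : Csum (fun j => g (Datatypes.S (Datatypes.S j))) N = S).
  { rewrite <- E1. apply (Csum_rotate (fun j => g (Datatypes.S j))).
    replace (Datatypes.S N) with (N + 1)%nat by lia. apply g_per. }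
  assert (Sd : forall j, node N (Datatypes.S j) = node N j + d) by (intros; apply node_S).
  assert (E3 : Csum (fun j => (F (u + node N (Datatypes.S j) + d) - F (u + node N (Datatypes.S j)) +
        (F (u + node N (Datatypes.S j) - d) - F (u + node N (Datatypes.S j))))
         * harmonic (- m) (node N (Datatypes.S j))) N
      = RtoC (- (2 - 2 * cos (mm * d))) * S).
  { rewrite (Csum_ext _ (fun j => harmonic m d * g (Datatypes.S (Datatypes.S j)) +
       (harmonic (- m) d * g j + -2 * g (Datatypes.S j)))).
    - rewrite !Csum_plus, !Csum_scal, E1, E2. fold S.
      rewrite <- Hcos.
      replace (harmonic m d * S + (harmonic (- m) d * S + -2 * S))
        with ((harmonic (- m) d + harmonic m d - 2) * S) by ring.
      f_equal. rewrite harmonic_opp_plus, opp_IZR.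
      replace (- IZR m * d)%R with (- (IZR m * d))%R by ring. rewrite cos_neg.
      rewrite <- RtoC_minus. f_equal. ring.
    - intros j _. unfold g.
      rewrite (Sd (Datatypes.S j)), (Sd j).
      replace (u + (node N j + d) - d) with (u + node N j) by ring.
      rewrite !harmonic_plus.
      replace (u + (node N j + d + d)) with (u + (node N j + d) + d) by ring.
      set (A := F (u + (node N j + d) + d)). set (A' := F (u + (node N j + d))).
      set (A'' := F (u + node N j)).
      pose proof (harmonic_opp m d) as I.
      transitivity (harmonic (- m) (node N j) * (harmonic (- m) d * (A + A'' - 2 * A'))); [ring|].
      transitivity (harmonic (- m) (node N j) * ((harmonic (- m) d * harmonic m d) * harmonic (- m) d * A
         + (harmonic (- m) d * A'' - 2 * harmonic (- m) d * A'))); [rewrite I; ring | ring]. }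
  assert (HB0 : forall j, (j <= N)%nat -> (Cmod (u + node N j) <= Cmod u + 8)%R).
  { intros j Hj. eapply Rle_trans; [apply Cmod_triangle|].
    pose proof (Cmod_node N j Hj HN'). pose proof PI_4. lra. }
  assert (Cd : Cmod d = d) by (rewrite Cmod_R; apply Rabs_pos_eq; lra).
  assert (K : (Cmod (RtoC (- (2 - 2 * cos (mm * d))) * S) <= INR N * (2 * (B * d ^ 2)))%R).
  { rewrite <- E3, <- Rsum_const. apply Csum_Cmod. intros j Hj.
    rewrite Cmod_mult. unfold node at 5. rewrite Cmod_harmonic_R, Rmult_1_r.
    set (w := u + node N (Datatypes.S j)).
    destruct (HT w (HB0 (Datatypes.S j) ltac:(lia))) as (_ & _ & H3).
    pose proof (H3 d ltac:(rewrite Cd; lra)) as T1. pose proof (H3 (- d) ltac:(rewrite Cmod_opp, Cd; lra)) as T2.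
    rewrite Cmod_opp, Cd in T2. rewrite Cd in T1.
    (* The first-order terms for d and -d cancel, leaving two quadratic remainders. *)
    replace (F (w + d) - F w + (F (w - d) - F w))
      with ((F (w + d) - F w - d * F' w) + (F (w + - d) - F w - - d * F' w))
      by (unfold Cminus; ring).
    eapply Rle_trans; [apply Cmod_triangle|]. lra. }
  rewrite Cmod_mult, Cmod_R, Rabs_Ropp in K.
  assert (Hmd : (0 <= mm * d <= PI)%R).
  { split; [apply Rmult_le_pos; lra|].
    replace PI with (INR N * d)%R by (unfold d; field; lra).
    apply Rmult_le_compat_r; [lra|]. apply le_INR in Hk.
    rewrite plus_INR, mult_INR in Hk. simpl in Hk. unfold mm. lra. }
  pose proof (cos_gap_le _ Hmd) as G.
  pose proof (pow2_ge_0 (mm * d)) as G0.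
  rewrite Rabs_pos_eq in K by lra.
  assert (K2 : ((mm * d) ^ 2 / 9 * Cmod S <= INR N * (2 * (B * d ^ 2)))%R).
  { eapply Rle_trans; [|exact K]. apply Rmult_le_compat_r; [apply Cmod_ge_0|exact G]. }
  unfold dft. fold g. fold S.
  replace (18 * B / mm ^ 2)%R with (18 * B * INR N / mm ^ 2 / INR N)%R by (field; lra).
  apply Cmod_mean_le; auto.
  apply (Rmult_le_reg_l ((mm * d) ^ 2 / 9)).
  - assert (0 < mm * d)%R by (apply Rmult_lt_0_compat; lra). nra.
  - eapply Rle_trans; [exact K2|]. right. field. lra.
Qed.

Lemma ex_series_inv_odd_sq (K : R) : ex_series (fun k => K / (2 * INR k + 1) ^ 2)%R.
Proof.
  apply (ex_series_scal_l K (fun k => / (2 * INR k + 1) ^ 2)%R).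
  set (a := fun k => (/ (2 * INR k + 1) ^ 2)%R).
  assert (P : forall k, (0 <= INR k)%R) by apply pos_INR.
  assert (A0 : forall k, (0 <= a k)%R).
  { intros k. unfold a. left. apply Rinv_0_lt_compat. specialize (P k). nra. }
  (* Comparison with the telescoping terms 1/(n+1) - 1/(n+2). *)
  assert (Hb : forall n, (Rsum a (S n) <= 2 - / (INR n + 1))%R).
  { induction n as [|n IH].
    - unfold a. simpl. lra.
    - change (Rsum a (S (S n))) with (Rsum a (S n) + a (S n))%R.
      assert (a (S n) <= / (INR n + 1) - / (INR (S n) + 1))%R.
      { unfold a. rewrite S_INR. specialize (P n).
        replace (/ (INR n + 1) - / (INR n + 1 + 1))%R
          with (/ ((INR n + 1) * (INR n + 2)))%R by (field; lra).
        apply Rinv_le_contravar; nra. }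
      lra. }
  destruct (ex_finite_lim_seq_incr (sum_n a) 2) as [l Hl].
  - intros n. rewrite <- !Rsum_sum_n. simpl. specialize (A0 (S n)). lra.
  - intros n. rewrite <- Rsum_sum_n. specialize (Hb n). specialize (P n).
    assert (0 < / (INR n + 1))%R by (apply Rinv_0_lt_compat; lra). lra.
  - exists l. exact Hl.
Qed.

Lemma CSeries_finite (a : nat -> C) (M : nat) :
  (forall k, (M <= k)%nat -> a k = 0) -> CSeries a = Csum a M.
Proof.
  intros H. apply CSeries_unique. apply Ccvg_spec. intros eps He.
  exists M. intros n Hn. replace n with (M + (n - M))%nat by lia.
  rewrite Csum_split, (Csum_ext (fun k => a (M + k)%nat) (fun _ => 0)), Csum_const.
  2:{ intros k _. apply H. lia. }
  replace (Csum a M + INR (n - M) * 0 - Csum a M) with (RtoC 0) by ring.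
  now rewrite Cmod_0.
Qed.

(* The odd frequencies below N in absolute value recover F exactly from its
   samples; the bound O(1/m^2) on the discrete coefficients lets N tend to
   infinity, where every single coefficient vanishes. *)
Theorem coef_zero_eq_0 (F : C -> C) : antiperiodic F -> entire F ->
  (forall m, Z.odd m = true -> coef m F = 0) -> forall u, F u = 0.
Proof.
  intros HP HE H0 u.
  destruct HE as [F' HT]. destruct (HT (Cmod u + 8)%R) as [B HB].
  assert (HE : entire F) by (exists F'; exact HT).
  assert (B0 : (0 <= B)%R).
  { destruct (HB u ltac:(lra)) as [H _]. pose proof (Cmod_ge_0 (F u)). lra. }
  set (M := fun n => (2 ^ (n + 1))%nat).
  assert (HM : forall n, dyadic n = (2 * M n)%nat).
  { intros n. unfold dyadic, M. rewrite Nat.add_succ_r. reflexivity. }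
  (* Extending the finite inversion sum by zeros gives, for each n, a full series with sum F u, to
     which Tannery's theorem applies with the majorant from [dft_le]. *)
  set (a := fun n k => if (k <? M n)%nat
      then dft (dyadic n) (odd_Z k) F u + dft (dyadic n) (- odd_Z k) F u else 0).
  assert (Hsum : forall n, CSeries (a n) = F u).
  { intros n. pose proof (dyadic_ge_4 n) as D4. rewrite HM in D4.
    rewrite (CSeries_finite _ (M n)).
    - rewrite <- (dft_inversion (M n) F u) by lia. apply Csum_ext. intros k Hk.
      unfold a. apply Nat.ltb_lt in Hk. rewrite Hk, HM. reflexivity.
    - intros k Hk. unfold a. apply Nat.ltb_ge in Hk. now rewrite Hk. }
  assert (Hdft : forall m, Z.odd m = true -> Ccvg (fun n => dft (dyadic n) m F u) 0).
  { intros m Hm.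
    apply Ccvg_ext with (fun n => harmonic m u * mean (dyadic n) (twist m F) u).
    - intros n. now rewrite dft_mean.
    - replace (RtoC 0) with (harmonic m u * coef m F) by (rewrite H0; [ring|exact Hm]).
      apply Ccvg_scal. now apply coef_cvg. }
  assert (L : Ccvg (fun n => CSeries (a n)) (CSeries (fun _ => 0))).
  { apply CSeries_tannery with (fun k => 36 * B / (2 * INR k + 1) ^ 2)%R.
    - intros n k. unfold a.
      assert (Q : (0 <= 18 * B / (2 * INR k + 1) ^ 2)%R).
      { pose proof (pos_INR k). apply Rdiv_le_0_compat; nra. }
      replace (36 * B / (2 * INR k + 1) ^ 2)%R
        with (18 * B / (2 * INR k + 1) ^ 2 + 18 * B / (2 * INR k + 1) ^ 2)%R
        by (unfold Rdiv; ring).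
      destruct (Nat.ltb_spec k (M n)) as [Hk|Hk]; [|rewrite Cmod_0; lra].
      eapply Rle_trans; [apply Cmod_triangle|].
      apply Rplus_le_compat; apply (dft_le F F') with (k := k); auto using dyadic_ge_4;
        rewrite HM; lia.
    - apply ex_series_inv_odd_sq.
    - intros k. unfold a.
      apply Ccvg_spec. intros eps He.
      assert (Lk : Ccvg (fun n => dft (dyadic n) (odd_Z k) F u + dft (dyadic n) (- odd_Z k) F u) (0 + 0)).
      { apply Ccvg_plus; apply Hdft; rewrite ?Z.odd_opp; apply odd_odd_Z. }
      destruct (proj1 (Ccvg_spec _ _) Lk eps He) as [N0 HN0].
      exists N0. intros n Hn. specialize (HN0 n Hn).
      rewrite Cplus_0_r in HN0.
      destruct (k <? M n)%nat; [exact HN0|].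
      replace (0 - 0) with (RtoC 0) by ring. now rewrite Cmod_0. }
  rewrite (CSeries_finite _ 0%nat) in L by reflexivity. simpl in L.
  apply (Ccvg_unique (fun n => CSeries (a n))); [|exact L].
  apply Ccvg_ext with (fun _ => F u); [intros n; now rewrite Hsum | apply Ccvg_const].
Qed.

(** * Infinite products and the triple product *)

Lemma Cprod_S (u : nat -> C) (n : nat) : Cprod u (S n) = Cprod u n * u n.
Proof. reflexivity. Qed.

Lemma Cprod_le (x : nat -> C) (b : nat -> R) (n : nat) : dominated x b ->
  (Cmod (Cprod (fun i => 1 - x i)%C n) <= exp (Series b))%R.
Proof.
  intros Hx. apply Rle_trans with (exp (Rsum b n)).
  - induction n as [|n IH].
    + simpl. rewrite Cmod_1, exp_0. lra.
    + rewrite Cprod_S, Cmod_mult. simpl Rsum. rewrite exp_plus.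
      apply Rmult_le_compat; auto using Cmod_ge_0.
      apply Rle_trans with (1 + b n)%R; [|apply exp_ineq1_le].
      eapply Rle_trans; [apply Cmod_triangle|]. rewrite Cmod_opp, Cmod_1.
      apply Rplus_le_compat_l, Hx.
  - apply exp_le_compat, Rsum_le_Series; [now apply dominated_ge_0 with x | apply Hx].
Qed.

(** A lower bound independent of n, so that the infinite product is nonzero; it rests on 1 - b >=
    exp(-b/(1-s)) for 0 <= b <= s < 1. *)
Lemma Cprod_ge (x : nat -> C) (b : nat -> R) (s : R) (n : nat) : dominated x b ->
  (s < 1)%R -> (forall i, b i <= s)%R ->
  (exp (- (Series b / (1 - s))) <= Cmod (Cprod (fun i => 1 - x i)%C n))%R.
Proof.
  intros Hx Hs Hb. pose proof (dominated_ge_0 _ _ Hx) as B0.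
  apply Rle_trans with (exp (- (Rsum b n / (1 - s)))).
  - apply exp_le_compat, Ropp_le_contravar.
    apply Rmult_le_compat_r; [left; apply Rinv_0_lt_compat; lra|].
    apply Rsum_le_Series; [exact B0 | apply Hx].
  - induction n as [|n IH].
    + simpl. unfold Rdiv. rewrite Rmult_0_l, Ropp_0, exp_0, Cmod_1. lra.
    + rewrite Cprod_S, Cmod_mult. simpl Rsum.
      replace (- ((Rsum b n + b n) / (1 - s)))%R
        with (- (Rsum b n / (1 - s)) + - (b n / (1 - s)))%R by (field; lra).
      rewrite exp_plus.
      apply Rmult_le_compat; auto; try (left; apply exp_pos).
      apply Rle_trans with (1 - b n)%R.
      * set (t := (b n / (1 - s))%R).
        assert (T0 : (0 <= t)%R).
        { apply Rdiv_le_0_compat; [apply B0 | lra]. }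
        assert (Tb : (b n = t * (1 - s))%R) by (unfold t; field; lra).
        pose proof (exp_ineq1_le t) as E.
        rewrite exp_Ropp. apply (Rmult_le_reg_l (exp t)); [apply exp_pos|].
        rewrite Rinv_r by (apply Rgt_not_eq, exp_pos).
        specialize (Hb n).
        (* Since b = t(1 - s), the product is 1 + t(s - b). *)
        assert (1 <= (1 + t) * (1 - b n))%R by nra. nra.
      * pose proof (proj1 Hx n) as Hn.
        pose proof (Cmod_triangle (1 - x n) (x n)) as T.
        replace (1 - x n + x n) with (RtoC 1) in T by ring. rewrite Cmod_1 in T. lra.
Qed.

(** Consecutive partial products differ by -x_n P_n with P_n bounded, so they are the partial sums
    of a dominated series. *)
Lemma Cprod_cvg (x : nat -> C) (b : nat -> R) : dominated x b ->
  exists l, Ccvg (Cprod (fun i => 1 - x i)) l.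
Proof.
  intros Hx. set (P := Cprod (fun i => 1 - x i)).
  assert (D : dominated (fun k => P k * - x k) (fun k => exp (Series b) * b k)%R).
  { split.
    - intros n. rewrite Cmod_mult, Cmod_opp.
      apply Rmult_le_compat; try apply Cmod_ge_0; [now apply Cprod_le | apply Hx].
    - apply (ex_series_scal_l (exp (Series b)) b), Hx. }
  exists (CSeries (fun k => P k * - x k) + 1).
  apply Ccvg_ext with (fun n => Csum (fun k => P k * - x k) n + 1).
  - intros n. induction n as [|n IH]; [unfold P; simpl; ring|].
    unfold P at 2. rewrite Cprod_S. fold P. rewrite <- IH. cbn [Csum].
    rewrite <- IH. ring.
  - apply Ccvg_plus; [|apply Ccvg_const]. eapply CSeries_cvg; eauto.
Qed.

Lemma dominated_qpow (a q : C) : (Cmod q < 1)%R ->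
  dominated (fun i => a * q ^ i) (fun i => Cmod a * Cmod q ^ i)%R.
Proof.
  intros Hq. split.
  - intros n. rewrite Cmod_mult, Cmod_pow. lra.
  - apply (ex_series_scal_l (Cmod a) (fun i => Cmod q ^ i)%R), ex_series_geom.
    rewrite Rabs_pos_eq; [exact Hq | apply Cmod_ge_0].
Qed.

Lemma qpoch_cvg (a q : C) : (Cmod q < 1)%R ->
  Ccvg (Cprod (fun i => 1 - a * q ^ i)) (qpoch_inf a q).
Proof.
  intros Hq. destruct (Cprod_cvg _ _ (dominated_qpow a q Hq)) as [l Hl].
  unfold qpoch_inf. now rewrite (Clim_seq_Ccvg _ _ Hl).
Qed.

Lemma Cprod_qpoch_ge (a q : C) : (Cmod q < 1)%R -> (Cmod a < 1)%R ->
  exists d, (0 < d)%R /\ forall n, (d <= Cmod (Cprod (fun i => 1 - a * q ^ i)%C n))%R.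
Proof.
  intros Hq Ha. eexists. split; [apply exp_pos|]. intros n.
  apply (Cprod_ge _ _ _ n (dominated_qpow a q Hq) Ha). intros i.
  rewrite <- (Rmult_1_r (Cmod a)) at 2.
  apply Rmult_le_compat_l; [apply Cmod_ge_0|].
  rewrite <- (pow1 i). apply pow_incr. split; [apply Cmod_ge_0 | lra].
Qed.

Lemma qpoch_neq_0 (a q : C) : (Cmod q < 1)%R -> (Cmod a < 1)%R -> qpoch_inf a q <> 0.
Proof.
  intros Hq Ha E. destruct (Cprod_qpoch_ge a q Hq Ha) as [d [Hd H]].
  pose proof (Ccvg_Cmod _ _ (qpoch_cvg a q Hq)) as L.
  pose proof (is_lim_seq_le _ _ _ _ H (is_lim_seq_const d) L) as K.
  simpl in K. rewrite E, Cmod_0 in K. lra.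
Qed.

Lemma Cprod_split3 (u : nat -> C) (n : nat) :
  Cprod u (3 * n) = Cprod (fun i => u (3 * i)%nat) n *
    Cprod (fun i => u (3 * i + 1)%nat) n * Cprod (fun i => u (3 * i + 2)%nat) n.
Proof.
  induction n as [|n IH]; [simpl; ring|].
  replace (3 * S n)%nat with (S (S (S (3 * n)))) by lia.
  rewrite !Cprod_S, IH.
  replace (S (3 * n)) with (3 * n + 1)%nat by lia.
  replace (S (3 * n + 1)) with (3 * n + 2)%nat by lia. ring.
Qed.

Lemma Cprod_ext (u v : nat -> C) (n : nat) :
  (forall i, u i = v i) -> Cprod u n = Cprod v n.
Proof. intros H. induction n as [|n IH]; simpl; [reflexivity|]. now rewrite IH, H. Qed.

(** Splitting the factors by exponent modulo 3. It brings the products of [Pi_q tau] to the base q^6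
    that occurs in [Pi_q (3 * tau)]. *)
Lemma qpoch_split3 (a q : C) : (Cmod q < 1)%R ->
  qpoch_inf a q = qpoch_inf a (q ^ 3) * qpoch_inf (a * q) (q ^ 3)
                    * qpoch_inf (a * q ^ 2) (q ^ 3).
Proof.
  intros Hq.
  assert (Hq3 : (Cmod (q ^ 3) < 1)%R).
  { rewrite Cmod_pow. pose proof (Cmod_ge_0 q). simpl. nra. }
  apply (Ccvg_unique (fun n => Cprod (fun i => 1 - a * q ^ i) (3 * n))).
  - apply (Ccvg_subseq _ _ (fun n => (3 * n)%nat)); [intros; lia|]. now apply qpoch_cvg.
  - apply Ccvg_ext with (fun n => Cprod (fun i => 1 - a * (q ^ 3) ^ i) n *
      Cprod (fun i => 1 - a * q * (q ^ 3) ^ i) n *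
      Cprod (fun i => 1 - a * q ^ 2 * (q ^ 3) ^ i) n).
    + intros n. rewrite Cprod_split3. f_equal; [f_equal|]; apply Cprod_ext; intros i;
        rewrite ?Cpow_add_r, Cpow_mult_r; ring.
    + repeat apply Ccvg_mult; now apply qpoch_cvg.
Qed.

Lemma Ccvg_inv (u : nat -> C) (l : C) (d : R) : (0 < d)%R ->
  (forall n, d <= Cmod (u n))%R -> Ccvg u l -> Ccvg (fun n => / u n) (/ l).
Proof.
  intros Hd Hu Hl.
  assert (HL : (d <= Cmod l)%R).
  { pose proof (is_lim_seq_le _ _ _ _ Hu (is_lim_seq_const d) (Ccvg_Cmod _ _ Hl)) as K.
    exact K. }
  assert (L0 : l <> 0) by (apply Cmod_gt_0; lra).
  apply Ccvg_bound with (fun n => / (d * d) * Cmod (u n - l))%R.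
  - intros n. specialize (Hu n).
    assert (U0 : u n <> 0) by (apply Cmod_gt_0; lra).
    replace (/ u n - / l) with (- (/ (u n * l) * (u n - l))) by (field; auto).
    rewrite Cmod_opp, Cmod_mult, Cmod_inv, Cmod_mult by now apply Cmult_neq_0.
    apply Rmult_le_compat_r; [apply Cmod_ge_0|].
    apply Rinv_le_contravar; [nra|]. apply Rmult_le_compat; lra.
  - replace 0%R with (/ (d * d) * 0)%R by ring.
    apply (is_lim_seq_scal_l _ _ 0%R Hl).
Qed.

(* 1 / (q;q)_k, extended by 0 to negative k so that the recurrence
   (1 - q^k) v_k = v_(k-1) holds for every integer k. *)
Definition inv_qfact (rho : C) (k : Z) : C :=
  if (0 <=? k)%Z
  then / Cprod (fun i => 1 - Cexp rho * Cexp rho ^ i) (Z.to_nat k) else 0.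

Lemma Cexp_mul_pow (rho : C) (i : nat) :
  Cexp rho * Cexp rho ^ i = Cexp (rho * IZR (Z.of_nat i + 1)).
Proof.
  rewrite <- Cpow_S, Cexp_pow, S_INR, INR_IZR_INZ, plus_IZR. f_equal. ring.
Qed.

Lemma Cmod_Cexp_lt_1 (rho : C) : (Re rho < 0)%R -> (Cmod (Cexp rho) < 1)%R.
Proof. intros H. rewrite Cmod_Cexp, <- exp_0. now apply exp_increasing. Qed.

Lemma one_sub_Cexp_neq_0 (rho : C) (k : Z) : (Re rho < 0)%R -> (0 < k)%Z ->
  1 - Cexp (rho * IZR k) <> 0.
Proof.
  intros Hr Hk E. assert (H : Cexp (rho * IZR k) = 1).
  { replace (Cexp (rho * IZR k)) with (1 - (1 - Cexp (rho * IZR k))) by ring.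
    rewrite E. ring. }
  pose proof (Cmod_Cexp_lt_1 (rho * IZR k)) as K. rewrite H, Cmod_1, re_scal_r in K.
  apply IZR_lt in Hk. assert (Re rho * IZR k < 0)%R by nra. lra.
Qed.

Lemma Cprod_qfact_neq_0 (rho : C) (n : nat) : (Re rho < 0)%R ->
  Cprod (fun i => 1 - Cexp rho * Cexp rho ^ i) n <> 0.
Proof.
  intros Hr. induction n as [|n IH]; [exact C1_nz|].
  rewrite Cprod_S. apply Cmult_neq_0; [exact IH|].
  rewrite Cexp_mul_pow. apply one_sub_Cexp_neq_0; [exact Hr | lia].
Qed.

Lemma inv_qfact_rec (rho : C) (k : Z) : (Re rho < 0)%R ->
  (1 - Cexp (rho * IZR k)) * inv_qfact rho k = inv_qfact rho (k - 1).
Proof.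
  intros Hr. unfold inv_qfact.
  destruct (Z.leb_spec 0 k) as [Hk|Hk], (Z.leb_spec 0 (k - 1)) as [Hk'|Hk']; try lia.
  - replace (Z.to_nat k) with (S (Z.to_nat (k - 1))) by lia.
    rewrite Cprod_S, Cexp_mul_pow, Z2Nat.id, Z.sub_add by exact Hk'.
    field. split.
    + now apply Cprod_qfact_neq_0.
    + apply one_sub_Cexp_neq_0; [exact Hr | lia].
  - replace k with 0%Z by lia. rewrite Cmult_0_r, Cexp_0. ring.
  - ring.
Qed.

Lemma inv_qfact_bounded (rho : C) : (Re rho < 0)%R ->
  exists K, (0 <= K)%R /\ forall k, (Cmod (inv_qfact rho k) <= K)%R.
Proof.
  intros Hr. pose proof (Cmod_Cexp_lt_1 rho Hr) as H1.
  destruct (Cprod_qpoch_ge _ _ H1 H1) as [d [Hd H]].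
  exists (/ d)%R. split; [left; now apply Rinv_0_lt_compat|].
  intros k. unfold inv_qfact. destruct (0 <=? k)%Z.
  - rewrite Cmod_inv by now apply Cprod_qfact_neq_0.
    now apply Rinv_le_contravar.
  - rewrite Cmod_0. left; now apply Rinv_0_lt_compat.
Qed.

Lemma inv_qfact_cvg (rho : C) (f : nat -> Z) (c : Z) : (Re rho < 0)%R ->
  (forall n, (Z.of_nat n - c <= f n)%Z) ->
  Ccvg (fun n => inv_qfact rho (f n)) (/ qpoch_inf (Cexp rho) (Cexp rho)).
Proof.
  intros Hr Hf. pose proof (Cmod_Cexp_lt_1 rho Hr) as H1.
  destruct (Cprod_qpoch_ge _ _ H1 H1) as [d [Hd H]].
  pose proof (Ccvg_inv _ _ d Hd H (qpoch_cvg _ _ H1)) as L.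
  apply Ccvg_spec. intros eps He.
  destruct (proj1 (Ccvg_spec _ _) L eps He) as [N HN].
  exists (N + Z.to_nat c)%nat. intros n Hn. specialize (Hf n). unfold inv_qfact.
  destruct (Z.leb_spec 0 (f n)) as [Hk|Hk]; [|lia].
  apply HN. lia.
Qed.

Lemma theta_term_succ (al be : C) (n : Z) :
  theta_term al be (n + 1) = theta_term al be n * Cexp (al * (2 * IZR n + 1) + be).
Proof.
  unfold theta_term. rewrite <- Cexp_plus, plus_IZR, RtoC_plus. f_equal. ring.
Qed.

Definition qpow (rho : C) (k : Z) : C := Cexp (rho * IZR k).

(* (-1)^n q^(n(n-1)/2) x^n for q = exp rho and x = exp xi. *)
Definition triple_monomial (rho xi : C) : Z -> C :=
  theta_term (rho / 2) (xi - rho / 2 + PI * Ci).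

(** Summand of the finite triple product: up to the factor (q;q)_(M+N), the two inverse factorials
    form a Gaussian binomial coefficient. They vanish outside -N <= n <= M, so the finite sum is a
    sum over all integers and index shifts have no boundary terms. *)
Definition triple_term (rho xi : C) (M N : nat) (n : Z) : C :=
  triple_monomial rho xi n *
    (inv_qfact rho (Z.of_nat M - n) * inv_qfact rho (Z.of_nat N + n)).

Lemma triple_succ (rho xi : C) (n : Z) :
  triple_monomial rho xi (n + 1) = triple_monomial rho xi n * (- Cexp xi * qpow rho n).
Proof.
  unfold triple_monomial. rewrite theta_term_succ. f_equal. unfold qpow.
  replace (rho / 2 * (2 * IZR n + 1) + (xi - rho / 2 + PI * Ci))
    with (rho * IZR n + xi + PI * Ci) by field.
  rewrite !Cexp_plus, Cexp_PI. ring.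
Qed.

Lemma qpow_plus (rho : C) (j k : Z) : qpow rho (j + k) = qpow rho j * qpow rho k.
Proof. unfold qpow. rewrite <- Cexp_plus, plus_IZR, RtoC_plus. f_equal. ring. Qed.

Lemma Re_half_neg (rho : C) : (Re rho < 0 -> Re (rho / 2) < 0)%R.
Proof.
  intros Hrho. replace (rho / 2) with (RtoC (/ 2) * rho).
  - rewrite re_scal_l. lra.
  - rewrite RtoC_inv by lra. unfold Cdiv. ring.
Qed.

Lemma triple_decay (rho xi : C) : (Re rho < 0)%R ->
  exists K, forall M N, Zdecay (triple_term rho xi M N) K.
Proof.
  intros Hrho.
  destruct (theta_term_decay _ (xi - rho / 2 + PI * Ci) (Re_half_neg rho Hrho)) as [K HK].
  destruct (inv_qfact_bounded rho Hrho) as [L [L0 HL]].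
  exists (L * L * K)%R. intros M N n. unfold triple_term. rewrite Cmult_comm, Cmod_mult.
  rewrite Rmult_assoc. apply Rmult_le_compat; try apply Cmod_ge_0; [|apply HK].
  rewrite Cmod_mult. apply Rmult_le_compat; try apply Cmod_ge_0; apply HL.
Qed.

(** The q-Pascal rule: with k = M + 1 - n and l = N + n, write 1 - q^(k+l) = (1 - q^k) + q^k (1 -
    q^l). Each bracket lowers one inverse factorial, and in the second part q^k times the monomial
    is -x q^M times the preceding monomial. *)
Lemma triple_step_l (rho xi : C) (M N : nat) : (Re rho < 0)%R ->
  (1 - qpow rho (Z.of_nat M + Z.of_nat N + 1)) * ZSum (triple_term rho xi (S M) N)
    = (1 - Cexp xi * qpow rho (Z.of_nat M)) * ZSum (triple_term rho xi M N).
Proof.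
  intros Hrho. destruct (triple_decay rho xi Hrho) as [K HK].
  pose proof (Zdecay_shift _ _ (-1) (HK M N)) as Hs.
  assert (ES : ZSum (fun n => triple_term rho xi M N (n + -1)%Z) = ZSum (triple_term rho xi M N)).
  { rewrite <- (ZSum_succ _ _ Hs). apply ZSum_ext. intros n. f_equal. lia. }
  replace ((1 - Cexp xi * qpow rho (Z.of_nat M)) * ZSum (triple_term rho xi M N))
    with (ZSum (triple_term rho xi M N) + - (Cexp xi * qpow rho (Z.of_nat M)) * ZSum (triple_term rho xi M N)) by ring.
  rewrite <- ES at 2.
  rewrite <- (ZSum_scal _ _ _ Hs), <- (ZSum_scal _ _ _ (HK (S M) N)).
  rewrite <- (ZSum_plus _ _ _ _ (HK M N) (Zdecay_scal _ _ _ Hs)).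
  apply ZSum_ext. intros n. unfold triple_term.
  replace (Z.of_nat (S M) - n)%Z with (Z.of_nat M + 1 - n)%Z by lia.
  replace (Z.of_nat M - n)%Z with (Z.of_nat M + 1 - n - 1)%Z by lia.
  replace (Z.of_nat M - (n + -1))%Z with (Z.of_nat M + 1 - n)%Z by lia.
  replace (Z.of_nat N + (n + -1))%Z with (Z.of_nat N + n - 1)%Z by lia.
  set (k := (Z.of_nat M + 1 - n)%Z). set (l := (Z.of_nat N + n)%Z).
  rewrite <- (inv_qfact_rec rho k Hrho), <- (inv_qfact_rec rho l Hrho).
  fold (qpow rho k) (qpow rho l).
  replace (Z.of_nat M + Z.of_nat N + 1)%Z with (k + l)%Z by (unfold k, l; lia).
  replace (Z.of_nat M) with (k + (n + -1))%Z at 1 by (unfold k; lia).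
  replace (triple_monomial rho xi n) with (triple_monomial rho xi (n + -1 + 1)) by (f_equal; lia).
  rewrite triple_succ, !qpow_plus. ring.
Qed.

(** The mirror rule, with k = M - n and l = N + n + 1: 1 - q^(k+l) = (1 - q^l) + q^l (1 - q^k), and
    q^l times the monomial is -(q^(N+1)/x) times the next one. *)
Lemma triple_step_r (rho xi : C) (M N : nat) : (Re rho < 0)%R ->
  (1 - qpow rho (Z.of_nat M + Z.of_nat N + 1)) * ZSum (triple_term rho xi M (S N))
    = (1 - qpow rho (Z.of_nat N + 1) / Cexp xi) * ZSum (triple_term rho xi M N).
Proof.
  intros Hrho. destruct (triple_decay rho xi Hrho) as [K HK].
  assert (x0 : Cexp xi <> 0) by apply Cexp_neq_0.
  pose proof (Zdecay_shift _ _ 1 (HK M N)) as Hs.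
  replace ((1 - qpow rho (Z.of_nat N + 1) / Cexp xi) * ZSum (triple_term rho xi M N))
    with (ZSum (triple_term rho xi M N) + - (qpow rho (Z.of_nat N + 1) / Cexp xi) * ZSum (triple_term rho xi M N)) by ring.
  rewrite <- (ZSum_succ _ _ (HK M N)) at 2.
  rewrite <- (ZSum_scal _ _ _ Hs), <- (ZSum_scal _ _ _ (HK M (S N))).
  rewrite <- (ZSum_plus _ _ _ _ (HK M N) (Zdecay_scal _ _ _ Hs)).
  apply ZSum_ext. intros n. unfold triple_term.
  replace (Z.of_nat (S N) + n)%Z with (Z.of_nat N + n + 1)%Z by lia.
  replace (Z.of_nat N + (n + 1))%Z with (Z.of_nat N + n + 1)%Z by lia.
  replace (Z.of_nat N + n)%Z with (Z.of_nat N + n + 1 - 1)%Z at 2 by lia.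
  replace (Z.of_nat M - (n + 1))%Z with (Z.of_nat M - n - 1)%Z by lia.
  set (k := (Z.of_nat M - n)%Z). set (l := (Z.of_nat N + n + 1)%Z).
  rewrite <- (inv_qfact_rec rho k Hrho), <- (inv_qfact_rec rho l Hrho).
  fold (qpow rho k) (qpow rho l).
  replace (Z.of_nat M + Z.of_nat N + 1)%Z with (k + l)%Z by (unfold k, l; lia).
  rewrite triple_succ.
  replace (qpow rho l) with (qpow rho (Z.of_nat N + 1) * qpow rho n).
  - rewrite qpow_plus. replace (qpow rho l) with (qpow rho (Z.of_nat N + 1) * qpow rho n).
    + field. exact x0.
    + rewrite <- qpow_plus. f_equal. unfold l. lia.
  - rewrite <- qpow_plus. f_equal. unfold l. lia.
Qed.

Lemma triple_0 (rho xi : C) : ZSum (triple_term rho xi 0 0) = 1.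
Proof.
  assert (Z0 : forall n, (n <> 0)%Z -> triple_term rho xi 0 0 n = 0).
  { intros n Hn. unfold triple_term, inv_qfact.
    destruct (Z.leb_spec 0 (Z.of_nat 0 - n)), (Z.leb_spec 0 (Z.of_nat 0 + n)); try ring. lia. }
  unfold ZSum. rewrite (CSeries_finite _ 1), (CSeries_finite (fun n => triple_term _ _ _ _ (- _ - 1)%Z) 0).
  - cbn [Csum]. unfold triple_term, triple_monomial, theta_term, inv_qfact. simpl.
    replace (rho / 2 * (0 * (0 * 1)) + (xi - rho / 2 + PI * Ci) * 0) with (RtoC 0) by ring.
    rewrite Cexp_0. field.
  - intros k _. apply Z0. lia.
  - intros k Hk. apply Z0. lia.
Qed.

(** Raising M or N by one multiplies both sides by one linear factor, so induction starts from the
    single nonzero term at M = N = 0. *)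
Lemma finite_triple_product (rho xi : C) (M N : nat) : (Re rho < 0)%R ->
  Cprod (fun i => 1 - Cexp rho * Cexp rho ^ i) (M + N) * ZSum (triple_term rho xi M N)
  = Cprod (fun i => 1 - Cexp xi * Cexp rho ^ i) M *
    Cprod (fun i => 1 - Cexp rho / Cexp xi * Cexp rho ^ i) N.
Proof.
  intros Hr.
  assert (EP : forall n, Cexp rho ^ n = qpow rho (Z.of_nat n)).
  { intros n. rewrite Cexp_pow. unfold qpow. rewrite <- INR_IZR_INZ. f_equal. ring. }
  induction M as [|M IH].
  - induction N as [|N IH].
    + simpl. rewrite triple_0. ring.
    + change (0 + S N)%nat with (S (0 + N)). rewrite !Cprod_S.
      rewrite Cexp_mul_pow.
      replace (Z.of_nat (0 + N) + 1)%Z with (Z.of_nat 0 + Z.of_nat N + 1)%Z by lia.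
      rewrite <- Cmult_assoc.
      fold (qpow rho (Z.of_nat 0 + Z.of_nat N + 1)).
      rewrite triple_step_r by exact Hr.
      transitivity ((1 - qpow rho (Z.of_nat N + 1) / Cexp xi) *
        (Cprod (fun i => 1 - Cexp rho * Cexp rho ^ i) (0 + N) * ZSum (triple_term rho xi 0 N)));
        [ring|].
      rewrite IH. unfold qpow. rewrite <- Cexp_mul_pow. unfold Cdiv. ring.
  - change (S M + N)%nat with (S (M + N)). rewrite !Cprod_S.
    rewrite Cexp_mul_pow.
    replace (Z.of_nat (M + N) + 1)%Z with (Z.of_nat M + Z.of_nat N + 1)%Z by lia.
    rewrite <- Cmult_assoc.
    fold (qpow rho (Z.of_nat M + Z.of_nat N + 1)).
    rewrite triple_step_l by exact Hr.
    transitivity ((1 - Cexp xi * qpow rho (Z.of_nat M)) *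
      (Cprod (fun i => 1 - Cexp rho * Cexp rho ^ i) (M + N) * ZSum (triple_term rho xi M N)));
      [ring|].
    rewrite IH, EP. ring.
Qed.

(** In the finite identity with M = N each inverse factorial tends to 1/L, where L = (q;q)_inf, so
    the sum tends to Theta / L^2 by Tannery; the prefactor tends to L. *)
Theorem jacobi_triple_product (rho xi : C) : (Re rho < 0)%R ->
  Theta (rho / 2) (xi - rho / 2 + PI * Ci) =
    qpoch_inf (Cexp rho) (Cexp rho) * qpoch_inf (Cexp xi) (Cexp rho) *
    qpoch_inf (Cexp rho / Cexp xi) (Cexp rho).
Proof.
  intros Hr. pose proof (Cmod_Cexp_lt_1 rho Hr) as H1.
  set (L := qpoch_inf (Cexp rho) (Cexp rho)).
  assert (L0 : L <> 0) by now apply qpoch_neq_0.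
  assert (T : Ccvg (fun N => ZSum (triple_term rho xi N N)) (/ (L * L) * Theta (rho / 2) (xi - rho / 2 + PI * Ci))).
  { destruct (triple_decay rho xi Hr) as [K HK].
    destruct (theta_term_decay _ (xi - rho / 2 + PI * Ci) (Re_half_neg rho Hr)) as [K' HK'].
    unfold Theta. rewrite <- (ZSum_scal _ _ _ HK').
    apply (ZSum_tannery _ _ K); [intros N; apply HK|].
    intros n. unfold triple_term.
    replace (/ (L * L) * theta_term (rho / 2) (xi - rho / 2 + PI * Ci) n)
      with (triple_monomial rho xi n * (/ L * / L)) by (unfold triple_monomial; field; exact L0).
    apply Ccvg_scal. apply Ccvg_mult.
    - apply inv_qfact_cvg with n; auto. intros; lia.
    - apply inv_qfact_cvg with (- n)%Z; auto. intros; lia. }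
  assert (T2 : Ccvg (fun N => Cprod (fun i => 1 - Cexp rho * Cexp rho ^ i) (N + N) *
     ZSum (triple_term rho xi N N)) (L * (/ (L * L) * Theta (rho / 2) (xi - rho / 2 + PI * Ci)))).
  { apply Ccvg_mult; [|exact T].
    apply (Ccvg_subseq _ _ (fun N => (N + N)%nat)); [intros; lia | now apply qpoch_cvg]. }
  assert (T3 : Ccvg (fun N => Cprod (fun i => 1 - Cexp rho * Cexp rho ^ i) (N + N) *
     ZSum (triple_term rho xi N N))
     (qpoch_inf (Cexp xi) (Cexp rho) * qpoch_inf (Cexp rho / Cexp xi) (Cexp rho))).
  { eapply Ccvg_ext; [intros n; symmetry; now apply finite_triple_product|].
    apply Ccvg_mult; now apply qpoch_cvg. }
  rewrite <- Cmult_assoc, <- (Ccvg_unique _ _ _ T2 T3). field. exact L0.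
Qed.

Lemma Theta_shift_2PI (al be : C) : Theta al (be + 2 * PI * Ci) = Theta al be.
Proof.
  apply ZSum_ext. intros n. unfold theta_term.
  replace (al * RtoC (IZR n) ^ 2 + (be + 2 * PI * Ci) * IZR n)
    with (al * RtoC (IZR n) ^ 2 + be * IZR n + 2 * PI * Ci * IZR n) by ring.
  rewrite Cexp_plus, Cexp_2PI_Z. ring.
Qed.

Lemma Theta_shift_2al (al be : C) : (Re al < 0)%R ->
  Theta al (be + 2 * al) = Cexp (- al - be) * Theta al be.
Proof.
  intros Ha. destruct (theta_term_decay al be Ha) as [K HK].
  unfold Theta. rewrite <- (ZSum_succ _ _ HK).
  rewrite <- (ZSum_scal _ _ _ (Zdecay_shift _ _ 1 HK)).
  apply ZSum_ext. intros n. unfold theta_term. rewrite <- Cexp_plus, plus_IZR, RtoC_plus.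
  f_equal. ring.
Qed.

Lemma Theta_reflect (al be : C) : (Re al < 0)%R ->
  Theta al be = Cexp (al - be) * Theta al (2 * al - be).
Proof.
  intros Ha. destruct (theta_term_decay al (2 * al - be) Ha) as [K HK].
  unfold Theta. rewrite <- (ZSum_scal _ _ _ HK).
  rewrite <- (ZSum_reflect (theta_term al be)).
  apply ZSum_ext. intros n. unfold theta_term.
  rewrite <- Cexp_plus, minus_IZR, opp_IZR, RtoC_minus, RtoC_opp. f_equal. ring.
Qed.

(** * The function theta_1: series over Z, symmetries and product *)

Lemma Re_PI_Ci (s : C) : Re (PI * Ci * s) = (- (PI * Im s))%R.
Proof. destruct s as [a b]. unfold Re, Im, RtoC, Ci, Cmult; simpl. ring. Qed.

Lemma Re_PI_Ci_neg (s : C) : (0 < Im s)%R -> (Re (PI * Ci * s) < 0)%R.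
Proof. intros H. rewrite Re_PI_Ci. pose proof PI_RGT_0. nra. Qed.

Lemma C2_neq_0 : RtoC 2 <> 0.
Proof. intros E. apply RtoC_inj in E. lra. Qed.

(** The terms of index n and -n - 1 share the Gaussian factor, as (2n+1)^2 is invariant under n ->
    -n - 1, and have opposite signs; together they form the sine term. *)
Lemma theta1_Theta (z s : C) : (0 < Im s)%R ->
  theta1 z s = - Ci * Cexp (PI * Ci * s / 4 + Ci * z)
               * Theta (PI * Ci * s) (PI * Ci * s + 2 * Ci * z + PI * Ci).
Proof.
  intros Hs. set (al := PI * Ci * s). set (be := al + 2 * Ci * z + PI * Ci).
  assert (Ha : (Re al < 0)%R) by now apply Re_PI_Ci_neg.
  destruct (theta_term_decay al be Ha) as [K HK].
  set (c := - Ci * Cexp (al / 4 + Ci * z)).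
  unfold Theta. rewrite <- (ZSum_scal c _ _ HK).
  pose proof (Zdecay_scal c _ _ HK) as HK'.
  unfold ZSum.
  rewrite <- (CSeries_plus _ _ _ _ (Zdecay_pos _ _ HK') (Zdecay_neg _ _ HK')).
  unfold theta1.
  assert (E : forall n : nat, c * theta_term al be (Z.of_nat n) +
     c * theta_term al be (- Z.of_nat n - 1) = 2 * ((-1) ^ n
    * Cexp (PI * Ci * s * (2 * INR n + 1) ^ 2 / 4) * Csin ((2 * INR n + 1) * z))).
  { intros n.
    assert (En : (-1) ^ n = Cexp (PI * Ci * INR n)).
    { rewrite <- Cexp_PI, Cexp_pow. f_equal. ring. }
    set (m := RtoC (INR n)) in *.
    set (X := Cexp (al * (2 * m + 1) ^ 2 / 4)).
    set (W := Cexp (Ci * ((2 * m + 1) * z))).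
    set (W' := Cexp (- (Ci * ((2 * m + 1) * z)))).
    assert (E1 : c * theta_term al be (Z.of_nat n) = - Ci * ((-1) ^ n * X * W)).
    { unfold c, theta_term. rewrite En. unfold X, W. rewrite <- !Cexp_plus.
      rewrite <- Cmult_assoc, <- Cexp_plus. rewrite <- INR_IZR_INZ. fold m.
      do 2 f_equal. unfold be. field. }
    assert (E2 : c * theta_term al be (- Z.of_nat n - 1) = Ci * ((-1) ^ n * X * W')).
    { unfold c, theta_term. rewrite En.
      (* The sign rule (-1)^n = -(-1)^(-n-1), which makes the pair a difference of exponentials. *)
      assert (F : Cexp (PI * Ci * m) = - Cexp (- (PI * Ci * m) - PI * Ci)).
      { replace (PI * Ci * m) with (- (PI * Ci * m) - PI * Ci + (PI * Ci + 2 * PI * Ci * IZR (Z.of_nat n))) at 1.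
        - rewrite !Cexp_plus, Cexp_2PI_Z, Cexp_PI. ring.
        - rewrite <- INR_IZR_INZ. fold m. ring. }
      rewrite F. unfold X, W'.
      replace (Ci * (- Cexp (- (PI * Ci * m) - PI * Ci) * Cexp (al * (2 * m + 1) ^ 2 / 4)
                 * Cexp (- (Ci * ((2 * m + 1) * z)))))
        with (- Ci * (Cexp (- (PI * Ci * m) - PI * Ci) * Cexp (al * (2 * m + 1) ^ 2 / 4)
                 * Cexp (- (Ci * ((2 * m + 1) * z))))) by ring.
      rewrite <- !Cexp_plus.
      rewrite <- Cmult_assoc, <- Cexp_plus, minus_IZR, opp_IZR, <- INR_IZR_INZ.
      rewrite RtoC_minus, RtoC_opp. fold m.
      do 2 f_equal. unfold be. field. }
    rewrite E1, E2. unfold Csin. fold W W'. fold al. fold X.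
    assert (CI2 : Ci * Ci = -1).
    { unfold Ci, Cmult, RtoC; simpl. f_equal; ring. }
    replace (2 * ((-1) ^ n * X * ((W - W') / (2 * Ci))))
      with ((-1) ^ n * X * (W - W') * / Ci) by (field; exact Ci_nz).
    rewrite Ci_inv. ring. }
  rewrite (CSeries_ext _ _ E).
  rewrite (CSeries_scal 2 (fun n : nat => (-1) ^ n
    * Cexp (PI * Ci * s * (2 * INR n + 1) ^ 2 / 4) * Csin ((2 * INR n + 1) * z))
    (fun n => / 2 * ((Cmod c * K) * exp (- INR n) + (Cmod c * K) * exp (- INR n)))%R); [reflexivity|].
  split.
  - intros n.
    apply (Rmult_le_reg_l 2); [lra|].
    rewrite <- Rmult_assoc, Rinv_r, Rmult_1_l by lra.
    replace 2%R with (Cmod 2) at 1 by (rewrite Cmod_R; apply Rabs_pos_eq; lra).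
    rewrite <- Cmod_mult, <- E.
    eapply Rle_trans; [apply Cmod_triangle|].
    apply Rplus_le_compat; [apply (Zdecay_pos _ _ HK') | apply (Zdecay_neg _ _ HK')].
  - apply (ex_series_ext (fun n => (Cmod c * K) * exp (- INR n))%R).
    + intros n. simpl. field.
    + apply ex_series_exp.
Qed.

Lemma theta1_antiperiodic (s : C) : (0 < Im s)%R -> antiperiodic (fun z => theta1 z s).
Proof.
  intros Hs z. rewrite !theta1_Theta by exact Hs.
  replace (PI * Ci * s + 2 * Ci * (z + PI) + PI * Ci)
    with (PI * Ci * s + 2 * Ci * z + PI * Ci + 2 * PI * Ci) by ring.
  rewrite Theta_shift_2PI.
  replace (PI * Ci * s / 4 + Ci * (z + PI)) with (PI * Ci * s / 4 + Ci * z + PI * Ci) by ring.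
  rewrite (Cexp_plus _ (PI * Ci)), Cexp_PI. ring.
Qed.

Lemma theta1_opp (z s : C) : (0 < Im s)%R -> theta1 (- z) s = - theta1 z s.
Proof.
  intros Hs. rewrite !theta1_Theta by exact Hs.
  set (al := PI * Ci * s).
  rewrite (Theta_reflect al (al + 2 * Ci * z + PI * Ci)) by now apply Re_PI_Ci_neg.
  replace (al + 2 * Ci * - z + PI * Ci)
    with (2 * al - (al + 2 * Ci * z + PI * Ci) + 2 * PI * Ci) by ring.
  rewrite Theta_shift_2PI.
  replace (al / 4 + Ci * z) with (al / 4 + Ci * - z + 2 * Ci * z) by ring.
  replace (al - (al + 2 * Ci * z + PI * Ci))
    with (- (2 * Ci * z) + - (PI * Ci)) by ring.
  rewrite (Cexp_plus _ (2 * Ci * z)), (Cexp_plus _ (- (PI * Ci))).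
  assert (P : Cexp (- (PI * Ci)) = -1).
  { pose proof (Cexp_opp (PI * Ci)) as K. rewrite Cexp_PI in K.
    replace (Cexp (- (PI * Ci))) with (- (Cexp (- (PI * Ci)) * -1)) by ring.
    rewrite K. ring. }
  rewrite P. pose proof (Cexp_opp (2 * Ci * z)) as K.
  set (T := Theta al (2 * al - (al + 2 * Ci * z + PI * Ci))).
  transitivity (- Ci * Cexp (al / 4 + Ci * - z) * (Cexp (- (2 * Ci * z)) * Cexp (2 * Ci * z)) * T);
    [rewrite K|]; ring.
Qed.

Lemma theta1_0 (s : C) : (0 < Im s)%R -> theta1 0 s = 0.
Proof.
  intros Hs. pose proof (theta1_opp 0 s Hs) as K.
  replace (- 0) with (RtoC 0) in K by ring.
  assert (K2 : 2 * theta1 0 s = 0).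
  { replace (2 * theta1 0 s) with (theta1 0 s + theta1 0 s) by ring.
    rewrite K at 1. ring. }
  destruct (Ceq_dec (theta1 0 s) 0) as [E|E]; [exact E|].
  exfalso. exact (Cmult_neq_0 _ _ C2_neq_0 E K2).
Qed.

Lemma theta1_quasi_periodic (z s : C) : (0 < Im s)%R ->
  theta1 (z + PI * s) s = - Cexp (- (PI * Ci * s)) * Cexp (- (2 * Ci * z)) * theta1 z s.
Proof.
  intros Hs. rewrite !theta1_Theta by exact Hs.
  set (al := PI * Ci * s).
  replace (al + 2 * Ci * (z + PI * s) + PI * Ci)
    with (al + 2 * Ci * z + PI * Ci + 2 * al) by (unfold al; ring).
  rewrite Theta_shift_2al by now apply Re_PI_Ci_neg.
  set (T := Theta _ _).
  transitivity (- Ci * (Cexp (al / 4 + Ci * (z + PI * s)) *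
     Cexp (- al - (al + 2 * Ci * z + PI * Ci))) * T); [ring|].
  rewrite <- Cexp_plus.
  replace (al / 4 + Ci * (z + PI * s) + (- al - (al + 2 * Ci * z + PI * Ci)))
    with (al / 4 + Ci * z + - al + - (2 * Ci * z) + - (PI * Ci)) by (unfold al; ring).
  rewrite !(Cexp_plus _ (- _)).
  pose proof (Cexp_opp (PI * Ci)) as K. rewrite Cexp_PI in K.
  replace (Cexp (- (PI * Ci))) with (- (Cexp (- (PI * Ci)) * -1)) by ring.
  rewrite K. ring.
Qed.

Lemma entire_theta1 (c d s : C) : (0 < Im s)%R -> entire (fun z => theta1 (c * z + d) s).
Proof.
  intros Hs.
  apply (entire_affine (fun z => theta1 z s)).
  set (al := PI * Ci * s).
  apply entire_ext with (fun z => - Ci * (Cexp (Ci * z + al / 4)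
     * Theta al (2 * Ci * z + (al + PI * Ci)))).
  - intros z. rewrite theta1_Theta by exact Hs. fold al.
    replace (al + 2 * Ci * z + PI * Ci) with (2 * Ci * z + (al + PI * Ci)) by ring.
    rewrite (Cplus_comm (al / 4)). ring.
  - apply entire_scal, entire_mult.
    + apply entire_exp, entire_plus; [apply entire_scal, entire_id | apply entire_const].
    + apply (entire_affine (Theta al)), entire_Theta, Re_PI_Ci_neg, Hs.
Qed.

(** The argument is parametrised so that the linear coefficient in [Theta] becomes xi - rho/2 + PI
    Ci with rho = 2 PI Ci s, the form taken by the triple product. *)
Lemma theta1_product (xi s : C) : (0 < Im s)%R ->
  theta1 ((xi - 2 * PI * Ci * s) / (2 * Ci)) s
  = - Ci * Cexp (xi / 2 - 3 / 4 * PI * Ci * s)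
    * (qpoch_inf (Cexp (2 * PI * Ci * s)) (Cexp (2 * PI * Ci * s))
       * qpoch_inf (Cexp xi) (Cexp (2 * PI * Ci * s))
       * qpoch_inf (Cexp (2 * PI * Ci * s) / Cexp xi) (Cexp (2 * PI * Ci * s))).
Proof.
  intros Hs. rewrite theta1_Theta by exact Hs.
  assert (Hr : (Re (2 * PI * Ci * s) < 0)%R).
  { replace (2 * PI * Ci * s) with (2 * (PI * Ci * s)) by ring.
    rewrite re_scal_l. pose proof (Re_PI_Ci_neg s Hs). lra. }
  rewrite <- jacobi_triple_product by exact Hr.
  f_equal; [do 2 f_equal|f_equal]; field; exact Ci_nz.
Qed.

(** * Theta functions of orders 1 and 3 *)

(** Entire theta functions of order [p] for the periods pi and pi s, with constant [b] in the
    multiplier. *)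
Definition quasi_periodic (s b : C) (p : Z) (F : C -> C) : Prop :=
  antiperiodic F /\ entire F /\
  forall z, F (z + PI * s) = b * harmonic (- (2 * p)) z * F z.

Lemma quasi_periodic_comb (s b : C) (p : Z) (x y : C) (F G : C -> C) :
  quasi_periodic s b p F -> quasi_periodic s b p G ->
  quasi_periodic s b p (fun z => x * F z + y * G z).
Proof.
  intros (HF1 & HF2 & HF3) (HG1 & HG2 & HG3). repeat split.
  - intros z. rewrite HF1, HG1. ring.
  - apply entire_plus; now apply entire_scal.
  - intros z. rewrite HF3, HG3. ring.
Qed.

(** Coefficients of index m and m + 2p differ by a nonzero factor, so a zero spreads in both
    directions through the residue class of m modulo 2p. *)
Lemma coef_zero_shift (s b : C) (p : Z) (F : C -> C) (m : Z) :
  b <> 0 -> quasi_periodic s b p F -> Z.odd m = true -> coef m F = 0 ->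
  forall j, coef (m + 2 * p * j) F = 0.
Proof.
  intros Hb (HP & HE & HQ) Hm H0.
  assert (R : forall k, Z.odd k = true -> coef k F = 0 <-> coef (k + 2 * p) F = 0).
  { intros k Hk. rewrite (coef_quasi_periodic k p (PI * s) b F Hk HP HE HQ).
    split; intros E; [|rewrite E; ring].
    destruct (Ceq_dec (coef (k + 2 * p) F) 0) as [Z|Z]; [exact Z|]. exfalso.
    refine (Cmult_neq_0 _ _ _ Z E). apply Cmult_neq_0; [exact Hb | apply harmonic_neq_0]. }
  assert (O : forall j, Z.odd (m + 2 * p * j) = true).
  { intros j. rewrite <- Z.mul_assoc, Z.odd_add_mul_2. exact Hm. }
  intros j. induction j as [|j IH|j IH] using Z.peano_ind.
  - now rewrite Z.mul_0_r, Z.add_0_r.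
  - replace (m + 2 * p * Z.succ j)%Z with (m + 2 * p * j + 2 * p)%Z by lia.
    apply (proj1 (R _ (O j))), IH.
  - apply R; [apply O|]. now replace (m + 2 * p * Z.pred j + 2 * p)%Z with (m + 2 * p * j)%Z by lia.
Qed.

Lemma odd_decompose (m : Z) : Z.odd m = true -> exists k, m = (2 * k + 1)%Z.
Proof. intros H. now apply Z.odd_spec. Qed.

Lemma order_1_eq_0 (s b : C) (F : C -> C) :
  b <> 0 -> quasi_periodic s b 1 F -> coef 1 F = 0 -> forall z, F z = 0.
Proof.
  intros Hb HF H0. apply coef_zero_eq_0; try apply HF.
  intros m Hm. destruct (odd_decompose m Hm) as [k ->].
  replace (2 * k + 1)%Z with (1 + 2 * 1 * k)%Z by lia.
  now apply (coef_zero_shift s b).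
Qed.

(** The cross combination has vanishing first coefficient, and for order 1 all odd indices form one
    class. *)
Lemma order_1_proportional (s b : C) (F G : C -> C) :
  b <> 0 -> quasi_periodic s b 1 F -> quasi_periodic s b 1 G ->
  forall z, coef 1 G * F z = coef 1 F * G z.
Proof.
  intros Hb HF HG z.
  pose proof (order_1_eq_0 s b _ Hb
    (quasi_periodic_comb s b 1 (coef 1 G) (- coef 1 F) F G HF HG)) as K.
  rewrite coef_comb in K; try reflexivity; try apply HF; try apply HG.
  assert (E : coef 1 G * F z + - coef 1 F * G z = 0) by (apply K; ring).
  replace (coef 1 G * F z) with (coef 1 G * F z + - coef 1 F * G z + coef 1 F * G z) by ring.
  rewrite E. ring.
Qed.

Definition odd_theta_3 (s b : C) (F : C -> C) : Prop :=
  quasi_periodic s b 3 F /\ forall z, F (- z) = - F z.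

Lemma odd_theta_3_comb (s b x y : C) (F G : C -> C) :
  odd_theta_3 s b F -> odd_theta_3 s b G ->
  odd_theta_3 s b (fun z => x * F z + y * G z).
Proof.
  intros [HF OF] [HG OG]. split; [now apply quasi_periodic_comb|].
  intros z. rewrite OF, OG. ring.
Qed.

Lemma odd_theta_3_coef (s b x y : C) (F G : C -> C) (m : Z) : Z.odd m = true ->
  odd_theta_3 s b F -> odd_theta_3 s b G ->
  coef m (fun z => x * F z + y * G z) = x * coef m F + y * coef m G.
Proof.
  intros Hm [HF _] [HG _]. apply coef_comb; auto; try apply HF; apply HG.
Qed.

(** Odd indices fall into the classes of 1, 3 and -1 modulo 6; oddness of F transfers the vanishing
    from 1 to -1. *)
Lemma odd_theta_3_eq_0 (s b : C) (F : C -> C) :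
  b <> 0 -> odd_theta_3 s b F -> coef 1 F = 0 -> coef 3 F = 0 -> forall z, F z = 0.
Proof.
  intros Hb [HF HO] H1 H3. apply coef_zero_eq_0; try apply HF.
  assert (H5 : coef (-1) F = 0).
  { pose proof (coef_odd 1 F eq_refl (proj1 HF) (proj1 (proj2 HF)) HO) as K.
    simpl in K. rewrite K, H1. ring. }
  intros m Hm. destruct (odd_decompose m Hm) as [k ->].
  pose proof (Z.div_mod k 3 ltac:(lia)) as D.
  pose proof (Z.mod_pos_bound k 3 ltac:(lia)) as B.
  set (j := (k / 3)%Z) in *.
  assert (C : (k mod 3 = 0 \/ k mod 3 = 1 \/ k mod 3 = 2)%Z) by lia.
  destruct C as [C|[C|C]]; rewrite C in D.
  - replace (2 * k + 1)%Z with (1 + 2 * 3 * j)%Z by lia. now apply (coef_zero_shift s b).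
  - replace (2 * k + 1)%Z with (3 + 2 * 3 * j)%Z by lia. now apply (coef_zero_shift s b).
  - replace (2 * k + 1)%Z with (-1 + 2 * 3 * (j + 1))%Z by lia. now apply (coef_zero_shift s b).
Qed.

(* Odd theta functions of order 3 form a plane: two independent members F2, F3
   span every third one. *)
Lemma odd_theta_3_dependent (s b u v : C) (F1 F2 F3 : C -> C) : b <> 0 ->
  odd_theta_3 s b F1 -> odd_theta_3 s b F2 -> odd_theta_3 s b F3 ->
  F2 u <> 0 -> F3 u = 0 -> F3 v <> 0 ->
  exists x y, forall z, F1 z = x * F2 z + y * F3 z.
Proof.
  intros Hb O1 O2 O3 N2 Z3 N3.
  set (x1 := coef 1 F1). set (x2 := coef 1 F2). set (x3 := coef 1 F3).
  set (y1 := coef 3 F1). set (y2 := coef 3 F2). set (y3 := coef 3 F3).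
  set (d := x2 * y3 - x3 * y2).
  (* If d = 0, the combinations of F2 and F3 that kill one coefficient kill the other as well and
     vanish identically. Evaluating them at u, where F3 = 0 and F2 is nonzero, makes both
     coefficients of F3 zero, against F3 v <> 0. *)
  assert (Hd : d <> 0).
  { intros D.
    assert (X3 : x3 = 0).
    { pose proof (odd_theta_3_eq_0 s b _ Hb (odd_theta_3_comb s b x3 (- x2) F2 F3 O2 O3)) as K.
      rewrite !(odd_theta_3_coef s b) in K by (auto || reflexivity).
      fold x2 x3 y2 y3 in K.
      specialize (K ltac:(ring)).
      assert (E : x3 * y2 + - x2 * y3 = 0) by (transitivity (- d); [unfold d; ring | rewrite D; ring]).
      specialize (K E u). cbv beta in K. rewrite Z3 in K.
      destruct (Ceq_dec x3 0) as [Z|Z]; [exact Z|]. exfalso.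
      apply (Cmult_neq_0 _ _ Z N2). rewrite <- K. ring. }
    assert (Y3 : y3 = 0).
    { pose proof (odd_theta_3_eq_0 s b _ Hb (odd_theta_3_comb s b y3 (- y2) F2 F3 O2 O3)) as K.
      rewrite !(odd_theta_3_coef s b) in K by (auto || reflexivity).
      fold x2 x3 y2 y3 in K.
      assert (E : y3 * x2 + - y2 * x3 = 0) by (transitivity d; [unfold d; ring | exact D]).
      specialize (K E ltac:(ring) u). cbv beta in K. rewrite Z3 in K.
      destruct (Ceq_dec y3 0) as [Z|Z]; [exact Z|]. exfalso.
      apply (Cmult_neq_0 _ _ Z N2). rewrite <- K. ring. }
    exact (N3 (odd_theta_3_eq_0 s b F3 Hb O3 X3 Y3 v)). }
  (* Cramer's rule for matching the coefficients of index 1 and 3. *)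
  exists ((x1 * y3 - x3 * y1) / d), ((x2 * y1 - x1 * y2) / d).
  pose proof (odd_theta_3_comb s b (x3 * y1 - x1 * y3) (x1 * y2 - x2 * y1) F2 F3 O2 O3) as O23.
  pose proof (odd_theta_3_eq_0 s b _ Hb (odd_theta_3_comb s b d 1 _ _ O1 O23)) as K.
  rewrite !(odd_theta_3_coef s b _ _ F1) in K by (auto || reflexivity).
  rewrite !(odd_theta_3_coef s b _ _ F2) in K by (auto || reflexivity).
  fold x1 x2 x3 y1 y2 y3 in K.
  specialize (K ltac:(unfold d; ring) ltac:(unfold d; ring)).
  intros z. specialize (K z). cbv beta in K.
  assert (E : d * F1 z = (x1 * y3 - x3 * y1) * F2 z + (x2 * y1 - x1 * y2) * F3 z).
  { transitivity (d * F1 z + 1 * ((x3 * y1 - x1 * y3) * F2 z + (x1 * y2 - x2 * y1) * F3 z)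
      + ((x1 * y3 - x3 * y1) * F2 z + (x2 * y1 - x1 * y2) * F3 z)); [ring|].
    rewrite K. ring. }
  transitivity (/ d * (d * F1 z)); [field; exact Hd|]. rewrite E. field. exact Hd.
Qed.

(** * The theta functions entering the identity *)

Lemma theta1_order_1 (s : C) : (0 < Im s)%R ->
  quasi_periodic s (- Cexp (- (PI * Ci * s))) 1 (fun z => theta1 z s).
Proof.
  intros Hs. repeat split.
  - now apply theta1_antiperiodic.
  - apply entire_ext with (fun z => theta1 (1 * z + 0) s).
    + intros z. f_equal. ring.
    + now apply entire_theta1.
  - intros z. rewrite theta1_quasi_periodic by exact Hs. do 2 f_equal.
    unfold harmonic. f_equal. simpl. ring.
Qed.

Lemma Copp_Cexp_neq_0 (w : C) : - Cexp w <> 0.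
Proof.
  intros E. apply (Cexp_neq_0 w). replace (Cexp w) with (- - Cexp w) by ring.
  rewrite E. ring.
Qed.

Lemma harmonic_m6 (z : C) : harmonic (- (2 * 3)) z = Cexp (- (2 * Ci * z)) ^ 3.
Proof. rewrite Cexp_pow. unfold harmonic. f_equal. simpl. rewrite !RtoC_plus. ring. Qed.

Lemma Cexp_pow_3 (w : C) : Cexp w ^ 3 = Cexp (3 * w).
Proof. rewrite Cexp_pow. f_equal. simpl. rewrite !RtoC_plus. ring. Qed.

Lemma Im_3 (s : C) : (0 < Im s)%R -> (0 < Im (3 * s))%R.
Proof. intros H. rewrite im_scal_l. lra. Qed.

Lemma theta1_add_PI (z s : C) : (0 < Im s)%R -> theta1 (z + PI) s = - theta1 z s.
Proof. intros Hs. exact (theta1_antiperiodic s Hs z). Qed.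

(** A shift of z by pi s moves 3z by one full quasi-period for the modulus 3s, and a shift by pi
    gives three sign changes. *)
Lemma theta1_triple_order_3 (s : C) : (0 < Im s)%R ->
  odd_theta_3 s (- Cexp (- (3 * (PI * Ci * s)))) (fun z => theta1 (3 * z) (3 * s)).
Proof.
  intros Hs. pose proof (Im_3 s Hs) as Hs3. split; [repeat split|].
  - intros z. replace (3 * (z + PI)) with (3 * z + PI + PI + PI) by ring.
    rewrite !theta1_add_PI by exact Hs3. ring.
  - apply entire_ext with (fun z => theta1 (3 * z + 0) (3 * s)).
    + intros z. f_equal. ring.
    + now apply entire_theta1.
  - intros z. replace (3 * (z + PI * s)) with (3 * z + PI * (3 * s)) by ring.
    rewrite theta1_quasi_periodic by exact Hs3. rewrite harmonic_m6, Cexp_pow_3.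
    do 2 f_equal; [do 3 f_equal; ring|]. f_equal. ring.
  - intros z. replace (3 * - z) with (- (3 * z)) by ring. now apply theta1_opp.
Qed.

Lemma theta1_cube_order_3 (s : C) : (0 < Im s)%R ->
  odd_theta_3 s (- Cexp (- (3 * (PI * Ci * s)))) (fun z => theta1 z s ^ 3).
Proof.
  intros Hs. destruct (theta1_order_1 s Hs) as (H1 & H2 & H3).
  split; [repeat split|].
  - intros z. rewrite theta1_add_PI by exact Hs. ring.
  - apply entire_ext with (fun z => theta1 z s * (theta1 z s * theta1 z s)).
    + intros z. ring.
    + apply entire_mult; [exact H2 | apply entire_mult; exact H2].
  - intros z. rewrite theta1_quasi_periodic by exact Hs.
    rewrite harmonic_m6. replace (- (3 * (PI * Ci * s))) with (3 * - (PI * Ci * s)) by ring.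
    rewrite <- (Cexp_pow_3 (- (PI * Ci * s))). ring.
  - intros z. rewrite theta1_opp by exact Hs. ring.
Qed.

Lemma theta1_half_period_quasi (z s : C) : (0 < Im s)%R ->
  theta1 (z + PI * s + PI / 2) s =
    Cexp (- (PI * Ci * s)) * Cexp (- (2 * Ci * z)) * theta1 (z + PI / 2) s.
Proof.
  intros Hs. replace (z + PI * s + PI / 2) with (z + PI / 2 + PI * s) by ring.
  rewrite theta1_quasi_periodic by exact Hs.
  replace (- (2 * Ci * (z + PI / 2))) with (- (2 * Ci * z) + - (PI * Ci)) by field.
  rewrite (Cexp_plus _ (- (PI * Ci))).
  pose proof (Cexp_opp (PI * Ci)) as K. rewrite Cexp_PI in K.
  replace (Cexp (- (PI * Ci))) with (- (Cexp (- (PI * Ci)) * -1)) by ring.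
  rewrite K. ring.
Qed.

Lemma theta1_half_period_even (z s : C) : (0 < Im s)%R ->
  theta1 (- z + PI / 2) s = theta1 (z + PI / 2) s.
Proof.
  intros Hs. replace (- z + PI / 2) with (- (z + - (PI / 2))) by ring.
  rewrite theta1_opp by exact Hs. rewrite <- theta1_add_PI by exact Hs.
  f_equal. field.
Qed.

(** The factor moved by pi/2 has the opposite sign in its multiplier and is even; being squared, it
    leaves sign and parity to [theta1 z s], as in the cube. *)
Lemma theta1_mixed_order_3 (s : C) : (0 < Im s)%R ->
  odd_theta_3 s (- Cexp (- (3 * (PI * Ci * s))))
    (fun z => theta1 z s * theta1 (z + PI / 2) s ^ 2).
Proof.
  intros Hs. destruct (theta1_order_1 s Hs) as (H1 & H2 & H3).
  split; [repeat split|].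
  - intros z. replace (z + PI + PI / 2) with (z + PI / 2 + PI) by ring.
    rewrite !theta1_add_PI by exact Hs. ring.
  - apply entire_ext with (fun z => theta1 z s *
      (theta1 (1 * z + PI / 2) s * theta1 (1 * z + PI / 2) s)).
    + intros z. rewrite Cmult_1_l. ring.
    + apply entire_mult; [exact H2|].
      apply entire_mult; now apply entire_theta1.
  - intros z. rewrite theta1_half_period_quasi, theta1_quasi_periodic by exact Hs.
    rewrite harmonic_m6. replace (- (3 * (PI * Ci * s))) with (3 * - (PI * Ci * s)) by ring.
    rewrite <- (Cexp_pow_3 (- (PI * Ci * s))). ring.
  - intros z. rewrite theta1_half_period_even, theta1_opp by exact Hs. ring.
Qed.

Lemma RtoC_PI_neq_0 : RtoC PI <> 0.
Proof. intros E. apply RtoC_inj in E. pose proof PI_RGT_0. lra. Qed.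

Lemma triplication (s z : C) : (0 < Im s)%R ->
  theta1 (PI / 2) s <> 0 -> theta1 (PI / 3) s <> 0 ->
  theta1 (PI / 3 + PI / 2) s <> 0 ->
  theta1 (3 * z) (3 * s) * theta1 (PI / 2) s ^ 3
  + theta1 z s ^ 3 * theta1 (PI / 2) (3 * s)
  = (theta1 (PI / 3) s / theta1 (PI / 3 + PI / 2) s) ^ 2
    * theta1 z s * theta1 (z + PI / 2) s ^ 2 * theta1 (PI / 2) (3 * s).
Proof.
  intros Hs NA NP NQ. pose proof (Im_3 s Hs) as Hs3.
  destruct (odd_theta_3_dependent s _ (PI / 2) (PI / 3) _ _ _ (Copp_Cexp_neq_0 _)
    (theta1_triple_order_3 s Hs) (theta1_cube_order_3 s Hs) (theta1_mixed_order_3 s Hs))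
    as (x & y & H).
  - now apply Cpow_nz.
  - replace (PI / 2 + PI / 2) with (0 + PI) by field.
    rewrite theta1_add_PI, theta1_0 by exact Hs. ring.
  - apply Cmult_neq_0; [exact NP | now apply Cpow_nz].
  - pose proof (H (PI / 2)) as E1. pose proof (H (PI / 3)) as E2. cbv beta in E1, E2.
    replace (PI / 2 + PI / 2) with (0 + PI) in E1 by field.
    rewrite theta1_add_PI, theta1_0 in E1 by exact Hs.
    replace (3 * (PI / 2)) with (PI / 2 + PI) in E1 by field.
    rewrite theta1_add_PI in E1 by exact Hs3.
    replace (3 * (PI / 3)) with (0 + PI) in E2 by field.
    rewrite theta1_add_PI, theta1_0 in E2 by exact Hs3.
    rewrite (H z).
    set (A := theta1 (PI / 2) s) in *. set (B := theta1 (PI / 2) (3 * s)) in *.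
    set (P := theta1 (PI / 3) s) in *. set (Q := theta1 (PI / 3 + PI / 2) s) in *.
    set (f := theta1 z s). set (g := theta1 (z + PI / 2) s).
    (* Both B and y are expressed as multiples of x, so that no division by x occurs and the claim
       becomes an algebraic identity in x. *)
    assert (EB : B = - (x * A ^ 3)).
    { replace B with (- - B) by ring. rewrite E1. ring. }
    assert (Ey : y = - (x * (P / Q) ^ 2)).
    { assert (K : x * P ^ 2 + y * Q ^ 2 = 0).
      { transitivity (/ P * (x * P ^ 3 + y * (P * Q ^ 2))); [field; exact NP|].
        rewrite <- E2. ring. }
      transitivity (/ Q ^ 2 * (x * P ^ 2 + y * Q ^ 2) - x * (P / Q) ^ 2); [field; exact NQ|].
      rewrite K. ring. }
    rewrite Ey, EB. ring.
Qed.

(** * The imaginary transformation *)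

Lemma Im_inv_neg (T : C) : (0 < Im T)%R -> T <> 0 /\ (0 < Im (-1 / T))%R.
Proof.
  intros H. assert (T0 : T <> 0).
  { intros E. rewrite E in H. unfold Im, RtoC in H; simpl in H. lra. }
  split; [exact T0|]. destruct T as [a b].
  unfold Cdiv, Cinv, Cmult, RtoC, Im in *; simpl in *.
  replace (-1 * (- b / (a * (a * 1) + b * (b * 1))) + 0 * (a / (a * (a * 1) + b * (b * 1))))%R
    with (b / (a * (a * 1) + b * (b * 1)))%R.
  - apply Rdiv_lt_0_compat; nra.
  - field. nra.
Qed.

Definition theta1_dual (T z : C) : C := Cexp (Ci * T * z ^ 2 / PI) * theta1 (T * z) T.

(** The two periods change roles: adding pi to z moves T z by the quasi-period pi T, whose
    multiplier the Gaussian cancels up to sign; adding -pi/T moves T z by -pi, and the Gaussian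
    alone supplies the multiplier. *)
Lemma theta1_dual_order_1 (T : C) : (0 < Im T)%R ->
  quasi_periodic (-1 / T) (- Cexp (- (PI * Ci * (-1 / T)))) 1 (theta1_dual T).
Proof.
  intros HT. destruct (Im_inv_neg T HT) as [T0 Hs].
  unfold theta1_dual. repeat split.
  - intros z. replace (T * (z + PI)) with (T * z + PI * T) by ring.
    rewrite theta1_quasi_periodic by exact HT.
    transitivity (- (Cexp (Ci * T * (z + PI) ^ 2 / PI) * Cexp (- (PI * Ci * T)) *
      Cexp (- (2 * Ci * (T * z)))) * theta1 (T * z) T); [ring|].
    rewrite <- !Cexp_plus.
    replace (Ci * T * (z + PI) ^ 2 / PI + - (PI * Ci * T) + - (2 * Ci * (T * z)))
      with (Ci * T * z ^ 2 / PI) by (field; exact RtoC_PI_neq_0).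
    ring.
  - apply entire_mult.
    + apply entire_exp.
      apply entire_ext with (fun z => Ci * T / PI * (z * z)).
      * intros z. field. exact RtoC_PI_neq_0.
      * apply entire_scal, entire_mult; apply entire_id.
    + apply entire_ext with (fun z => theta1 (T * z + 0) T).
      * intros z. f_equal. ring.
      * now apply entire_theta1.
  - intros z.
    assert (E : theta1 (T * (z + PI * (-1 / T))) T = - theta1 (T * z) T).
    { replace (T * z) with (T * (z + PI * (-1 / T)) + PI) by (field; exact T0).
      rewrite theta1_add_PI by exact HT. ring. }
    rewrite E.
    replace (Ci * T * (z + PI * (-1 / T)) ^ 2 / PI)
      with (Ci * T * z ^ 2 / PI + - (PI * Ci * (-1 / T)) + - (2 * Ci * z))
      by (field; split; [exact T0 | exact RtoC_PI_neq_0]).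
    rewrite !Cexp_plus.
    replace (harmonic (- (2 * 1)) z) with (Cexp (- (2 * Ci * z))).
    + ring.
    + unfold harmonic. f_equal. simpl. ring.
Qed.

Definition triple_qpoch (a q : C) : C :=
  qpoch_inf q q * qpoch_inf a q * qpoch_inf (q / a) q.

(** The two inequalities say |x| < 1 and |q/x| < 1 for x = exp xi and q = exp rho, so no factor of
    the three products vanishes. *)
Lemma triple_qpoch_neq_0 (xi rho : C) : (Re rho < Re xi < 0)%R ->
  triple_qpoch (Cexp xi) (Cexp rho) <> 0.
Proof.
  intros [H1 H2]. unfold triple_qpoch.
  assert (Hr : (Cmod (Cexp rho) < 1)%R) by (apply Cmod_Cexp_lt_1; lra).
  assert (E : Cexp rho / Cexp xi = Cexp (rho - xi)).
  { unfold Cminus. rewrite Cexp_plus. pose proof (Cexp_opp xi) as K.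
    transitivity (Cexp rho * (Cexp (- xi) * Cexp xi) / Cexp xi).
    - rewrite K, Cmult_1_r. reflexivity.
    - field. apply Cexp_neq_0. }
  rewrite E.
  repeat apply Cmult_neq_0; apply qpoch_neq_0; auto; apply Cmod_Cexp_lt_1; auto.
  unfold Cminus. rewrite re_plus, re_opp. lra.
Qed.

(* The argument [c * tau] of [theta1] with modulus [3 * tau] is where the
   triple product has factors in integral powers of [q]. *)
Lemma theta1_dual_product (tau z : C) (c : R) : (0 < Im tau)%R -> (0 < c < 3)%R ->
  3 * z = c * PI ->
  theta1_dual (3 * tau) z =
    Ci * Cexp (PI * Ci * tau * (c ^ 2 / 3 - c + 3 / 4))
    * triple_qpoch (Cexp (PI * Ci * tau * (6 - 2 * c))) (Cexp (PI * Ci * tau * 6))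
  /\ theta1_dual (3 * tau) z <> 0.
Proof.
  intros Ht Hc Hz. pose proof (Im_3 tau Ht) as HT.
  set (t := PI * Ci * tau).
  assert (E : theta1_dual (3 * tau) z =
    Ci * Cexp (t * (c ^ 2 / 3 - c + 3 / 4))
    * triple_qpoch (Cexp (t * (6 - 2 * c))) (Cexp (t * 6))).
  { unfold theta1_dual.
    assert (Ez : z = c * PI / 3) by (rewrite <- Hz; field).
    (* The product formula gives the value at -c pi tau; oddness of [theta1] then turns the
       prefactor -i into i. *)
    replace (3 * tau * z) with (- ((t * (6 - 2 * c) - 2 * PI * Ci * (3 * tau)) / (2 * Ci))).
    2:{ rewrite Ez. unfold t. field. exact Ci_nz. }
    rewrite theta1_opp, theta1_product by exact HT.
    unfold triple_qpoch.
    replace (2 * PI * Ci * (3 * tau)) with (t * 6) by (unfold t; ring).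
    replace (t * (c ^ 2 / 3 - c + 3 / 4)) with
      (Ci * (3 * tau) * z ^ 2 / PI + (t * (6 - 2 * c) / 2 - 3 / 4 * PI * Ci * (3 * tau))).
    - rewrite (Cexp_plus (Ci * (3 * tau) * z ^ 2 / PI)). ring.
    - rewrite Ez. unfold t. field. exact RtoC_PI_neq_0. }
  split; [exact E|]. rewrite E.
  apply Cmult_neq_0; [apply Cmult_neq_0; [exact Ci_nz | apply Cexp_neq_0]|].
  apply triple_qpoch_neq_0.
  pose proof (Re_PI_Ci_neg tau Ht) as N. fold t in N.
  replace (t * (6 - 2 * c)) with (t * RtoC (6 - 2 * c)%R)
    by (rewrite RtoC_minus, RtoC_mult; reflexivity).
  rewrite !re_scal_r. nra.
Qed.

(** Both functions have order 1 with the same multiplier. The constant is the quotient of their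
    first coefficients, each nonzero because neither function is identically zero. *)
Lemma theta1_dual_proportional (T : C) : (0 < Im T)%R ->
  (exists w, theta1_dual T w <> 0) ->
  exists k : C, k <> 0 /\ forall z, theta1 z (-1 / T) = k * theta1_dual T z.
Proof.
  intros HT [w Hw]. destruct (Im_inv_neg T HT) as [T0 Hs].
  set (s := -1 / T) in *.
  pose proof (theta1_order_1 s Hs) as QF. pose proof (theta1_dual_order_1 T HT) as QG.
  fold s in QG.
  pose proof (order_1_proportional _ _ _ _ (Copp_Cexp_neq_0 _) QF QG) as K.
  set (f := coef 1 (fun z => theta1 z s)) in *. set (g := coef 1 (theta1_dual T)) in *.
  cbv beta in K.
  assert (G0 : g <> 0).
  { intros E. apply Hw. exact (order_1_eq_0 _ _ _ (Copp_Cexp_neq_0 _) QG E w). }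
  assert (F0 : f <> 0).
  { intros E.
    pose proof (order_1_eq_0 _ _ _ (Copp_Cexp_neq_0 _) QF E) as Z.
    (* A point where [theta1] is visibly nonzero: xi = PI Ci s has half the real part of rho = 2 PI
       Ci s. *)
    specialize (Z ((PI * Ci * s - 2 * PI * Ci * s) / (2 * Ci))). cbv beta in Z.
    rewrite theta1_product in Z by exact Hs. revert Z.
    apply Cmult_neq_0; [apply Cmult_neq_0; [|apply Cexp_neq_0]|].
    - intros E'. apply Ci_nz. replace Ci with (- - Ci) by ring. rewrite E'. ring.
    - apply (triple_qpoch_neq_0 (PI * Ci * s)).
      pose proof (Re_PI_Ci_neg s Hs) as N.
      replace (2 * PI * Ci * s) with (2 * (PI * Ci * s)) by ring.
      rewrite re_scal_l. lra. }
  exists (f / g). split.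
  - intros E. apply F0. transitivity (f / g * g); [field; exact G0 | rewrite E; ring].
  - intros z. transitivity (/ g * (g * theta1 z s)); [field; exact G0|].
    rewrite K. field. exact G0.
Qed.

(** In base q^6, (q^2;q^2) consists of the products starting at q^2, q^4, q^6, and (q;q^2) of those
    starting at q, q^3, q^5. Those at q^6 and q^3 cancel against [Pi_q (3 * tau)]; the rest pair up
    as the triple products with x = q^4 and x = q. The exponential is q^(1/4 - 3/4). *)
Lemma Pi_q_ratio (tau : C) : (0 < Im tau)%R ->
  Pi_q tau / Pi_q (3 * tau) =
    Cexp (- (PI * Ci * tau / 2)) *
    (triple_qpoch (nome tau ^ 4) (nome tau ^ 6) / triple_qpoch (nome tau) (nome tau ^ 6)) ^ 2.
Proof.
  intros Ht. set (q := nome tau).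
  assert (Nq : (Re (PI * Ci * tau) < 0)%R) by now apply Re_PI_Ci_neg.
  assert (Hq : (Cmod q < 1)%R) by now apply Cmod_Cexp_lt_1.
  assert (Q0 : q <> 0) by apply Cexp_neq_0.
  assert (Hp : forall n, (Cmod (q ^ S n) < 1)%R).
  { intros n. unfold q, nome. rewrite Cexp_pow. apply Cmod_Cexp_lt_1.
    rewrite re_scal_l. pose proof (pos_INR n). rewrite S_INR. nra. }
  assert (P0 : forall n m, qpoch_inf (q ^ S n) (q ^ S m) <> 0).
  { intros n m. apply qpoch_neq_0; apply Hp. }
  assert (q3 : nome (3 * tau) = q ^ 3).
  { unfold q, nome. rewrite Cexp_pow_3. f_equal. ring. }
  unfold Pi_q. rewrite q3. fold q.
  rewrite (qpoch_split3 (q ^ 2) (q ^ 2)) by apply Hp.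
  rewrite (qpoch_split3 q (q ^ 2)) by apply Hp.
  unfold triple_qpoch.
  replace (q ^ 6 / q ^ 4) with (q ^ 2) by (field; exact Q0).
  replace (q ^ 6 / q) with (q ^ 5) by (field; exact Q0).
  replace ((q ^ 2) ^ 3) with (q ^ 6) by ring.
  replace ((q ^ 3) ^ 2) with (q ^ 6) by ring.
  replace (q ^ 2 * q ^ 2) with (q ^ 4) by ring.
  replace (q ^ 2 * (q ^ 2) ^ 2) with (q ^ 6) by ring.
  replace (q * q ^ 2) with (q ^ 3) by ring.
  replace (q * (q ^ 2) ^ 2) with (q ^ 5) by ring.
  replace (Cexp (PI * Ci * tau / 4))
    with (Cexp (- (PI * Ci * tau / 2)) * Cexp (PI * Ci * (3 * tau) / 4))
    by (rewrite <- Cexp_plus; f_equal; field).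
  pose proof (P0 0 5)%nat as N1. pose proof (P0 2 5)%nat as N3.
  pose proof (P0 4 5)%nat as N5. pose proof (P0 5 5)%nat as N6.
  rewrite Cpow_1_r in N1.
  field. repeat split; auto. apply Cexp_neq_0.
Qed.

Theorem theorem3 (tau : C) (htau : (0 < Im tau)%R) (z : C) :
  let tau' := - 1 / tau in
  theta1 (3 * z) tau' * theta1 (PI / 2) (tau' / 3) ^ 3
  + theta1 z (tau' / 3) ^ 3 * theta1 (PI / 2) tau'
  = Pi_q tau / Pi_q (3 * tau)
    * theta1 z (tau' / 3) * theta1 (z + PI / 2) (tau' / 3) ^ 2
    * theta1 (PI / 2) tau'.
Proof.
  intros tau'.
  assert (T0 : tau <> 0) by now apply Im_inv_neg.
  set (s := tau' / 3).
  assert (Es : s = -1 / (3 * tau)).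
  { unfold s, tau'. field. exact T0. }
  assert (E3 : tau' = 3 * s) by (unfold s; field).
  assert (Hs : (0 < Im s)%R) by (rewrite Es; apply Im_inv_neg, Im_3, htau).
  (* The values c = 3/2, 1, 5/2 solve 3 z = c pi at z = pi/2, pi/3, 5 pi/6; the last two produce x =
     q^(6-2c) = q^4 and q. *)
  destruct (theta1_dual_product tau (PI / 2) (3 / 2) htau ltac:(lra)) as [_ N1].
  { rewrite RtoC_div by lra. field. }
  destruct (theta1_dual_product tau (PI / 3) 1 htau ltac:(lra)) as [D2 N2].
  { field. }
  destruct (theta1_dual_product tau (PI / 3 + PI / 2) (5 / 2) htau ltac:(lra)) as [D3 N3].
  { rewrite RtoC_div by lra. field. }
  destruct (theta1_dual_proportional (3 * tau) (Im_3 tau htau)) as (k & K0 & K);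
    [now exists (PI / 3)|].
  rewrite <- Es in K. rewrite E3.
  rewrite triplication; rewrite ?K; try (now apply Cmult_neq_0); [|exact Hs].
  do 3 f_equal.
  rewrite Pi_q_ratio by exact htau.
  (* The proportionality constant [k] cancels in the quotient. *)
  transitivity ((theta1_dual (3 * tau) (PI / 3) / theta1_dual (3 * tau) (PI / 3 + PI / 2)) ^ 2).
  { field. split; [exact N3 | exact K0]. }
  rewrite D3 in N3. rewrite D2, D3.
  assert (q4 : Cexp (PI * Ci * tau * (6 - 2 * 1)) = nome tau ^ 4).
  { unfold nome. rewrite Cexp_pow. f_equal. simpl. rewrite !RtoC_plus. ring. }
  assert (q6 : Cexp (PI * Ci * tau * 6) = nome tau ^ 6).
  { unfold nome. rewrite Cexp_pow. f_equal. simpl. rewrite !RtoC_plus. ring. }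
  assert (q1 : Cexp (PI * Ci * tau * (6 - 2 * (5 / 2)%R)) = nome tau).
  { unfold nome. f_equal. rewrite RtoC_div by lra. field. }
  rewrite q1, q6 in N3. rewrite q1, q4, q6.
  set (t := PI * Ci * tau).
  set (U := triple_qpoch (nome tau ^ 4) (nome tau ^ 6)) in *.
  set (V := triple_qpoch (nome tau) (nome tau ^ 6)) in *.
  assert (NV : V <> 0).
  { intros E. apply N3. rewrite E. ring. }
  set (w := t * ((5 / 2)%R ^ 2 / 3 - (5 / 2)%R + 3 / 4)).
  (* The exponents c^2/3 - c + 3/4 are 1/12 for c = 1 and 1/3 for c = 5/2; their difference -1/4,
     doubled by squaring, is the q^(-1/2) of [Pi_q_ratio]. *)
  replace (t * (1 ^ 2 / 3 - 1 + 3 / 4)) with (w + - (t / 4)).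
  2:{ unfold w. rewrite RtoC_div by lra. field. }
  replace (- (t / 2)) with (- (t / 4) + - (t / 4)) by field.
  rewrite !Cexp_plus. field. repeat split; auto using Ci_nz, Cexp_neq_0.
Qed.
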